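(* Every germ of a smooth nondegenerate fibration of $\mathbb R^n$ by oriented affine $k$-planes extends to such a fibration of all of $\mathbb R^n$. That is, if $T\subset\mathbb R^n$ is an open set carrying a smooth nondegenerate fibration by oriented affine $k$-planes and $P$ is one of its fibers, then there is a smooth nondegenerate fibration of all of $\mathbb R^n$ by oriented affine $k$-planes which coincides with the given one on some open neighborhood of $P$.
   Context: $G_k(n)$ denotes the Grassmannian of oriented linear $k$-planes in $\mathbb R^n$. A fibration of an open set $T\subset\mathbb R^n$ by oriented affine $k$-planes is a family of pairwise disjoint oriented affine $k$-planes with union $T$ such that the map sending a point to its fiber is continuous; it is smooth if the map $\pi\colon T\to G_k(n)$, sending $x$ to the oriented linear $k$-plane parallel to the fiber through $x$, is smooth (and the fibration is locally smoothly trivial). For $u\in G_k(n)$ let $\varphi_u\colon \mathrm{Hom}(u,u^\perp)\to G_k(n)$ send a linear map $L$ to its graph $\{t+Lt:t\in u\}$, oriented via $u$; it is a diffeomorphism onto a neighborhood of $u$. A smooth fibration is nondegenerate if for every $x\in T$, with $u=\pi(x)$, the linear map $D_x=d(\varphi_u^{-1}\circ\pi|_{(x+u^\perp)\cap T})_x\colon u^\perp\to \mathrm{Hom}(u,u^\perp)$ has the property that $D_x(\xi)$ is injective for every nonzero $\xi\in u^\perp$ (i.e. $(\xi,t)\mapsto D_x(\xi)t$ is a nonsingular bilinear map; equivalently, $\pi$ restricted to $x+u^\perp$ is an immersion at $x$ transverse to the bad cone $\{u'\in G_k(n): u'\cap u\neq 0\}$). A bilinear map $\beta$ is nonsingular if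 $\beta(a,b)=0$ implies $a=0$ or $b=0$. *)

(* Defs.v *)
From HB Require Import structures.
From mathcomp Require Import all_boot all_order all_algebra.
From mathcomp Require Import all_classical all_reals all_analysis.
Set Implicit Arguments. Unset Strict Implicit. Unset Printing Implicit Defensive.
Import Order.TTheory GRing.Theory Num.Theory.
Import numFieldNormedType.Exports.
Local Open Scope classical_set_scope.
Local Open Scope ring_scope.

Fixpoint iderive (R : numFieldType) (V W : normedModType R)
    (f : V -> W) (vs : seq V) : V -> W :=
  if vs is v :: vs' then (fun x => derive (iderive f vs') x v) else f.

Definition smooth_on (R : numFieldType) (V W : normedModType R)
    (U : set V) (f : V -> W) : Prop :=
  forall (vs : seq V) (x : V), U x ->
    (forall v : V, derivable (iderive f vs) x v) /\
    {for x, continuous (iderive f vs)}.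

(* An oriented linear k-plane u of R^n (a point of G_k(n)) is represented by a
   frame: a k x n matrix of rank k whose rows form a positively oriented basis
   of u.  Two frames represent the same oriented plane iff they differ by a
   k x k matrix of positive determinant. *)
Definition frame_equiv (R : realType) (k n : nat) (A B : 'M[R]_(k, n)) : Prop :=
  exists M : 'M[R]_k, 0 < \det M /\ B = M *m A.

Definition in_perp (R : realType) (k n : nat) (A : 'M[R]_(k, n)) (xi : 'rV[R]_n) :=
  xi *m A^T = 0.

Definition fiber (R : realType) (k n : nat) (F : 'rV[R]_n -> 'M[R]_(k, n))
    (x : 'rV[R]_n) : set 'rV[R]_n :=
  [set y | exists c : 'rV[R]_k, y = x + c *m F x].

(* A fibration of the open set T by oriented affine k-planes, encoded by the
   map x |-> (frame of) the oriented direction of the fiber through x: every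
   x in T lies on the oriented affine plane x + span (F x) (oriented by F x),
   that plane lies in T, and every point of it carries the same oriented plane.
   (Hence these planes are pairwise disjoint or equal, and cover T.) *)
Definition fibration (R : realType) (k n : nat) (T : set 'rV[R]_n)
    (F : 'rV[R]_n -> 'M[R]_(k, n)) : Prop :=
  [/\ open T,
      (forall x, T x -> row_free (F x)),
      (forall x, T x -> fiber F x `<=` T) &
      (forall x y, T x -> fiber F x y -> frame_equiv (F x) (F y))].

(* pi : T -> G_k(n) is smooth: locally it is represented by a smooth frame field *)
Definition smooth_direction (R : realType) (k n : nat) (T : set 'rV[R]_n)
    (F : 'rV[R]_n -> 'M[R]_(k, n)) : Prop :=
  forall x, T x -> exists (U : set 'rV[R]_n) (G : 'rV[R]_n -> 'M[R]_(k, n)),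
    [/\ open U, U x, U `<=` T, smooth_on U G &
        (forall y, U y -> frame_equiv (F y) (G y))].

(* Local smooth triviality: around every point there is an open set V, which is
   a union of fibers, and a diffeomorphism
     Phi : B x R^k -> V,  Phi (b, c) = s b + c *m G b   (B open in R^(n-k))
   carrying each slice {b} x R^k onto the oriented fiber through s b. *)
Definition locally_trivial (R : realType) (k n : nat) (T : set 'rV[R]_n)
    (F : 'rV[R]_n -> 'M[R]_(k, n)) : Prop :=
  forall x, T x ->
  exists (B : set 'rV[R]_(n - k)) (s : 'rV[R]_(n - k) -> 'rV[R]_n)
         (G : 'rV[R]_(n - k) -> 'M[R]_(k, n)) (V : set 'rV[R]_n)
         (Psi : 'rV[R]_n -> 'rV[R]_(n - k) * 'rV[R]_k),
    [/\ open B, open V, V x & V `<=` T] /\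
    [/\ smooth_on B s, smooth_on B G & smooth_on V Psi] /\
    (forall b, B b -> frame_equiv (F (s b)) (G b)) /\
        [/\ (forall b c, B b -> V (s b + c *m G b)),
            (forall b c, B b -> Psi (s b + c *m G b) = (b, c)) &
            (forall y, V y -> B (Psi y).1 /\
                              s (Psi y).1 + (Psi y).2 *m G (Psi y).1 = y)].

(* The chart phi_u^{-1}: for the oriented plane u (frame A) and an oriented
   plane w (frame W), M : 'M_n (acting on row vectors) restricted to u is the
   linear map L : u -> u^perp whose graph {t + t L : t in u}, oriented via u,
   is w.  (Only the restriction of M to u matters.) *)
Definition graph_of (R : realType) (k n : nat) (A W : 'M[R]_(k, n)) (M : 'M[R]_n) : Prop :=
  A *m M *m A^T = 0 /\ frame_equiv (A + A *m M) W.

(* Nondegeneracy at every x in T, with u = pi(x) (frame F x):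
   Lf y = phi_u^{-1}(pi y) for y in (x + u^perp) near x, and
   D_x(xi) t = derivative at x along xi of  y |-> (phi_u^{-1}(pi y)) t,
   required nonzero for all nonzero xi in u^perp and nonzero t in u. *)
Definition nondegenerate (R : realType) (k n : nat) (T : set 'rV[R]_n)
    (F : 'rV[R]_n -> 'M[R]_(k, n)) : Prop :=
  forall x, T x -> exists (U : set 'rV[R]_n) (Lf : 'rV[R]_n -> 'M[R]_n),
    [/\ open U, U x, U `<=` T,
        (forall y, U y -> in_perp (F x) (y - x) -> graph_of (F x) (F y) (Lf y)) &
        (forall (xi : 'rV[R]_n) (t : 'rV[R]_n),
            in_perp (F x) xi -> xi != 0 -> (t <= F x)%MS -> t != 0 ->
            derivable (fun y => t *m Lf y) x xi /\
            derive (fun y => t *m Lf y) x xi != 0)].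

Definition smooth_nondeg_fibration (R : realType) (k n : nat) (T : set 'rV[R]_n)
    (F : 'rV[R]_n -> 'M[R]_(k, n)) : Prop :=
  [/\ fibration T F, smooth_direction T F, locally_trivial T F & nondegenerate T F].

(* Main.v *)
(** Write [A] for the frame of the fibre through [x0], [B] for a basis of its
    orthogonal complement.  Near [x0] the fibres are the graphs
    [{x0 + b B + c (A + L b B)}] with [L] smooth and [L 0 = 0].  Nondegeneracy at
    [x0] says that the bilinear map [(c, b) |-> c (dL_0 b)] is nonsingular; moreover
    [b |-> b + c (dL_0 b)] is injective for every [c], because [L] is constant along
    fibres, so a kernel vector [b] would be annihilated by [dL_0] at the point
    [x0 + c A].  By compactness [|a b + c (dL_0 b)| >= kappa max(|a|, |c|) |b|], and
    this survives replacing [dL_0] by any [L'] such that [L' - dL_0] has a small global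
    Lipschitz constant.  Choosing such an [L'] equal to [L] near [0], the maps
    [b |-> b + c (L' b)] are bijective for every [c] (Banach's fixed point theorem), the
    graphs of [L'] fill the whole space, and the slice coordinate [b] is a smooth
    function of the point by the inverse function argument. *)

Require Import Defs.
From HB Require Import structures.
From mathcomp Require Import all_boot all_order all_algebra.
From mathcomp Require Import all_classical all_reals all_analysis.
From mathcomp Require Import ring lra.
Set Implicit Arguments.
Unset Strict Implicit.
Unset Printing Implicit Defensive.
Import Order.TTheory GRing.Theory Num.Theory.
Import numFieldNormedType.Exports.
Local Open Scope classical_set_scope.
Local Open Scope ring_scope.

(** * Functions of class C^r *)

Section Cr.
Context {R : realType} {V W : normedModType R}.
Implicit Types (U : set V) (f g : V -> W) (m : nat).

Lemma diff_eps f x : differentiable f x -> forall e : R, 0 < e ->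
  \forall y \near x, `|f y - f x - 'd f x (y - x)| <= e * `|y - x|.
Proof.
move=> df e e0.
have /diffE fE := df.
have fE' : f = (fun y => f x + 'd f x (y - x)) +o_ x (fun y => y - x).
  by rewrite funeqE => y; rewrite [LHS]fE lim_id.
have /eqaddoP /(_ _ e0) := fE'.
apply: filterS => y /=; rewrite !fctE.
by rewrite opprD addrA.
Qed.

Lemma eps_diff f x (df : {linear V -> W}) : continuous df ->
  (forall e : R, 0 < e ->
    \forall y \near x, `|f y - f x - df (y - x)| <= e * `|y - x|) ->
  differentiable f x /\ 'd f x = df :> (V -> W).
Proof.
move=> dfc H.
have fE : f = (fun y => f x + df (y - x)) +o_ x (fun y => y - x).
  apply/eqaddoP => e e0; apply: filterS (H _ e0) => y /=.
  by rewrite !fctE opprD addrA.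
have dfx : differentiable f x.
  apply/diffP => /=.
  apply: (@getPex _ (fun (df : {linear V -> W}) => continuous df /\
    forall y, f y = f (lim (nbhs x)) + df (y - lim (nbhs x))
                  +o_(y \near x) (y - lim (nbhs x)))).
  exists df; split=> //; apply: eqaddoEx => z.
  by rewrite lim_id // [LHS](congr1 (@^~ z) fE).
split=> //; apply: diff_unique => //.
apply/eqaddoP => e e0.
have := H _ e0; rewrite (near_shift 0) subr0.
by apply: filterS => y /=; rewrite !fctE/= addrK opprD addrA.
Qed.

Lemma differentiable_near f g x :
  (\forall y \near x, f y = g y) -> differentiable f x -> differentiable g x.
Proof.
move=> fg df.
have [] // := @eps_diff g x ('d f x).
  exact: diff_continuous.
move=> e e0; move: (diff_eps df e0) (fg).
by apply: filterS2 => y + <-; rewrite -(nbhs_singleton fg).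
Qed.

(* Unlike [smooth_on], which only mentions directional derivatives, [Cr] asks for
   Frechet differentiability, so that the chain rule applies. *)
Fixpoint Cr m U f : Prop :=
  if m is m'.+1 then
    (forall x, U x -> differentiable f x) /\ (forall v, Cr m' U ('D_v f))
  else forall x, U x -> {for x, continuous f}.

Lemma Cr_cts m U f : Cr m U f -> forall x, U x -> {for x, continuous f}.
Proof.
case: m => [//|m] [df _] x Ux; exact/differentiable_continuous/df.
Qed.

Lemma CrW m U f : Cr m.+1 U f -> Cr m U f.
Proof.
elim: m f => [|m IH] f Cf; first exact: Cr_cts Cf.
by case: Cf => df Df; split=> // v; apply: IH.
Qed.

Lemma Cr_sub m U U' f : U' `<=` U -> Cr m U f -> Cr m U' f.
Proof.
move=> sU; elim: m f => [|m IH] f /=; first by move=> Cf x /sU; exact: Cf.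
by case=> df Df; split=> [x /sU|v]; [exact: df|exact: IH].
Qed.

Lemma near_open U x (P : V -> Prop) : open U -> U x -> (forall y, U y -> P y) ->
  \forall y \near x, P y.
Proof. by move=> oU Ux UP; apply: filterS UP _; exact: open_nbhs_nbhs. Qed.

Lemma Cr_eq m U f g : open U -> (forall x, U x -> f x = g x) ->
  Cr m U f -> Cr m U g.
Proof.
move=> oU; elim: m f g => [|m IH] f g fg /=.
  move=> Cf x Ux; have fgx : \forall y \near x, f y = g y by exact: near_open fg.
  rewrite /prop_for /continuous_at -(fg _ Ux).
  by apply: cvg_trans (Cf _ Ux); exact: near_eq_cvg.
move=> [df Df]; split=> [x Ux|v].
  by apply: differentiable_near (df _ Ux); exact: near_open fg.
apply: IH (Df v) => x Ux; apply: near_eq_derive; exact: near_open fg.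
Qed.

Lemma Cr_cst m U (c : W) : open U -> Cr m U (cst c).
Proof.
move=> oU; elim: m c => [|m IH] c; first by move=> x _; exact: cst_continuous.
by split=> // v; apply: Cr_eq (IH 0) => // x _; rewrite derive_cst.
Qed.

Lemma CrD m U f g : open U -> Cr m U f -> Cr m U g ->
  Cr m U (fun x => f x + g x).
Proof.
move=> oU; elim: m f g => [|m IH] f g /=.
  by move=> Cf Cg x Ux; apply: cvgD; [exact: Cf|exact: Cg].
move=> [df Df] [dg Dg]; split=> [x Ux|v].
  exact: differentiableD (df _ Ux) (dg _ Ux).
apply: Cr_eq (IH _ _ (Df v) (Dg v)) => // x Ux.
by rewrite [RHS]deriveD//; apply: diff_derivable; [exact: df|exact: dg].
Qed.

Lemma Cr_sum m U (I : Type) (r : seq I) (P : pred I) (f : I -> V -> W) :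
  open U -> (forall i, P i -> Cr m U (f i)) ->
  Cr m U (fun x => \sum_(i <- r | P i) f i x).
Proof.
move=> oU Cf; elim: r => [|i r IH].
  by apply: Cr_eq (@Cr_cst m U 0 oU) => // x _; rewrite big_nil.
case: (boolP (P i)) => Pi; last first.
  by apply: Cr_eq IH => // x _; rewrite big_cons (negbTE Pi).
apply: Cr_eq (CrD oU (Cf _ Pi) IH) => // x _; by rewrite big_cons Pi.
Qed.

Lemma Cr_smooth U f : open U -> (forall m, Cr m U f) -> smooth_on U f.
Proof.
move=> oU + vs; elim/last_ind: vs f => [|vs v IH] f Cf x Ux.
  split=> [v|]; last exact: (Cf 0%N).
  by have [df _] := Cf 1%N; apply/diff_derivable/df.
have iE g : iderive g (rcons vs v) = iderive ('D_v g) vs.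
  by elim: vs {IH} => //= a s ->.
by rewrite iE; apply: IH => // m; have [_ /(_ v)] := Cf m.+1.
Qed.

End Cr.

Section CrLin.
Context {R : realType} {V W : normedModType R}.

Lemma CrZl m U (k : V -> R) (w : W) : open U -> Cr m U k -> Cr m U (fun x => k x *: w).
Proof.
move=> oU; elim: m k => [|m IH] k /=.
  by move=> Ck x Ux; apply: cvgZr_tmp; exact: Ck.
move=> [dk Dk]; split=> [x Ux|v]; first exact/differentiableZl/dk.
apply: Cr_eq (IH _ (Dk v)) => // x Ux.
rewrite !deriveE; [|exact/differentiableZl/dk|exact/dk].
by rewrite diffZl//; exact: dk.
Qed.

Lemma Cr_linear m (U : set V) (l : {linear V -> W}) :
  open U -> continuous l -> Cr m U l.
Proof.
move=> oU cl; case: m => [|m]; first by move=> x _; exact: cl.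
split=> [x _|v]; first exact: linear_differentiable.
apply: (@Cr_eq _ _ _ m U (cst (l v))) => //; last exact: Cr_cst.
by move=> x _; rewrite deriveE ?diff_lin//; exact: linear_differentiable.
Qed.

Lemma Cr_lin_comp (W' : normedModType R) m (U : set V) (f : V -> W)
    (l : {linear W -> W'}) : open U -> continuous l ->
  Cr m U f -> Cr m U (fun x => l (f x)).
Proof.
move=> oU cl; elim: m f => [|m IH] f /=.
  by move=> Cf x Ux; apply: continuous_comp; [exact: Cf|exact: cl].
have dl z : differentiable l z by exact: linear_differentiable.
move=> [df Df]; split=> [x Ux|v].
  by apply: differentiable_comp => //; exact: df.
apply: Cr_eq (IH _ (Df v)) => // x Ux.
rewrite !deriveE; [|by apply: differentiable_comp => //; exact: df|exact/df].
by rewrite [in RHS]diff_comp//= ?diff_lin//; exact: df.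
Qed.

End CrLin.

Section CrScalar.
Context {R : realType} {V : normedModType R}.
Implicit Types (U : set V) (f g : V -> R) (m : nat).

Lemma CrM m U f g : open U -> Cr m U f -> Cr m U g ->
  Cr m U (fun x => f x * g x).
Proof.
move=> oU; elim: m f g => [|m IH] f g.
  by move=> Cf Cg x Ux; apply: cvgM; [exact: Cf|exact: Cg].
move=> Cf Cg; have [df Df] := Cf; have [dg Dg] := Cg.
split=> [x Ux|v]; first exact: differentiableM (df _ Ux) (dg _ Ux).
apply: Cr_eq (CrD oU (IH _ _ (CrW Cf) (Dg v)) (IH _ _ (CrW Cg) (Df v))) => //.
by move=> x Ux; rewrite [RHS]deriveM//; apply: diff_derivable;
  [exact: df|exact: dg].
Qed.

Lemma CrX m U f n : open U -> Cr m U f -> Cr m U (fun x => f x ^+ n).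
Proof.
move=> oU Cf; elim: n => [|n IH].
  by apply: Cr_eq (Cr_cst m (1 : R) oU) => // x _; rewrite expr0.
by apply: Cr_eq (CrM oU Cf IH) => // x _; rewrite exprS.
Qed.

Lemma CrMl m U (k : R) f : open U -> Cr m U f -> Cr m U (fun x => k * f x).
Proof. by move=> oU; apply: CrM => //; exact: Cr_cst. Qed.

Lemma CrN m U f : open U -> Cr m U f -> Cr m U (fun x => - f x).
Proof.
by move=> oU Cf; apply: Cr_eq (CrMl (-1) oU Cf) => // x _; rewrite mulN1r.
Qed.

Lemma CrB m U f g : open U -> Cr m U f -> Cr m U g ->
  Cr m U (fun x => f x - g x).
Proof. by move=> oU Cf Cg; apply: CrD => //; exact: CrN. Qed.

Lemma Cr_prod m U (I : Type) (r : seq I) (P : pred I) (f : I -> V -> R) :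
  open U -> (forall i, P i -> Cr m U (f i)) ->
  Cr m U (fun x => \prod_(i <- r | P i) f i x).
Proof.
move=> oU Cf; elim: r => [|i r IH].
  by apply: Cr_eq (Cr_cst m (1 : R) oU) => // x _; rewrite big_nil.
case: (boolP (P i)) => Pi; last first.
  by apply: Cr_eq IH => // x _; rewrite big_cons (negbTE Pi).
by apply: Cr_eq (CrM oU (Cf _ Pi) IH) => // x _; rewrite big_cons Pi.
Qed.

Lemma CrV m U f : open U -> (forall x, U x -> f x != 0) -> Cr m U f ->
  Cr m U (fun x => (f x)^-1).
Proof.
move=> oU f0; elim: m => [|m IH].
  by move=> Cf x Ux; apply: cvgV; [exact: f0|exact: Cf].
move=> Cf; have [df Df] := Cf; have CV := IH (CrW Cf).
split=> [x Ux|v]; first by apply: differentiableV; [exact: df|exact: f0].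
apply: Cr_eq (CrN oU (CrM oU (CrM oU CV CV) (Df v))) => // x Ux.
rewrite [RHS]deriveV; [|exact: f0|exact/diff_derivable/df].
by rewrite scaleNr -[RHS]/(- (_ * _)) -exprVn expr2.
Qed.

End CrScalar.

Section CrMatrix.
Context {R : realType} {V : normedModType R}.
Implicit Types (U : set V) (m : nat).

Lemma Cr_lin m (W W' : normedModType R) U (f : V -> W) (l : W -> W') :
  open U -> linear l -> continuous l -> Cr m U f -> Cr m U (fun x => l (f x)).
Proof.
move=> oU ll cl Cf.
pose lM := GRing.isLinear.Build _ _ _ _ l ll.
pose L : {linear W -> W'} := HB.pack l lM.
exact: (@Cr_lin_comp _ _ _ _ m U f L).
Qed.

Lemma Cr_coord m U p q (f : V -> 'M[R]_(p, q)) i j : open U -> Cr m U f ->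
  Cr m U (fun x => f x i j).
Proof.
move=> oU; apply: (Cr_lin (l := fun M : 'M[R]_(p, q) => M i j : R)) => //.
  by move=> k A B; rewrite !mxE.
exact: coord_continuous.
Qed.

Lemma Cr_mx m U p q (f : V -> 'M[R]_(p, q)) : open U ->
  (forall i j, Cr m U (fun x => f x i j)) -> Cr m U f.
Proof.
move=> oU Cf; apply: (@Cr_eq _ _ _ _ _
    (fun x => \sum_i \sum_j f x i j *: delta_mx i j)) => //.
  by move=> x _; rewrite -matrix_sum_delta.
by do 2!(apply: Cr_sum => // ? _); apply: CrZl.
Qed.

Lemma Cr_mulmx m U p q r (f : V -> 'M[R]_(p, q)) (g : V -> 'M[R]_(q, r)) :
  open U -> Cr m U f -> Cr m U g -> Cr m U (fun x => f x *m g x).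
Proof.
move=> oU Cf Cg; apply: Cr_mx => // i j.
apply: (@Cr_eq _ _ _ _ _ (fun x => \sum_k f x i k * g x k j)) => //.
  by move=> x _; rewrite mxE.
by apply: Cr_sum => // k _; apply: CrM => //; exact: Cr_coord.
Qed.

Lemma Cr_mulmxr m U p q r (f : V -> 'M[R]_(p, q)) (B : 'M[R]_(q, r)) :
  open U -> Cr m U f -> Cr m U (fun x => f x *m B).
Proof. by move=> oU Cf; apply: Cr_mulmx => //; exact: Cr_cst. Qed.

Lemma Cr_mulmxl m U p q r (A : 'M[R]_(p, q)) (f : V -> 'M[R]_(q, r)) :
  open U -> Cr m U f -> Cr m U (fun x => A *m f x).
Proof. by move=> oU Cf; apply: Cr_mulmx => //; exact: Cr_cst. Qed.

Lemma Cr_det m U p (f : V -> 'M[R]_p) :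
  open U -> Cr m U f -> Cr m U (fun x => \det (f x)).
Proof.
move=> oU Cf; apply: Cr_sum => // s _; apply: CrMl => //.
by apply: Cr_prod => // i _; exact: Cr_coord.
Qed.

Lemma Cr_invmx m U p (f : V -> 'M[R]_p) : open U ->
  (forall x, U x -> f x \in unitmx) -> Cr m U f -> Cr m U (fun x => invmx (f x)).
Proof.
move=> oU fu Cf; apply: Cr_mx => // i j.
apply: (@Cr_eq _ _ _ _ _ (fun x => (\det (f x))^-1 *
   ((-1) ^+ (j + i) * \det (row' j (col' i (f x)))))) => //.
  by move=> x Ux; rewrite /invmx fu// !mxE.
apply: CrM => //.
  by apply: CrV => //; [move=> x /fu; rewrite unitmxE unitfE|exact: Cr_det].
apply: CrMl => //; apply: Cr_det => //; apply: Cr_mx => // a b.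
apply: (@Cr_eq _ _ _ _ _ (fun x => f x (lift j a) (lift i b))) => //.
  by move=> x _; rewrite !mxE.
exact: Cr_coord.
Qed.

Lemma linear_continuous_mx p q (W : normedModType R) (l : 'M[R]_(p, q) -> W) :
  linear l -> continuous l.
Proof.
move=> ll x.
pose lM := GRing.isLinear.Build _ _ _ _ l ll.
pose L : {linear 'M[R]_(p, q) -> W} := HB.pack l lM.
have : Cr 0 setT (fun A : 'M[R]_(p, q) =>
    \sum_i \sum_j A i j *: l (delta_mx i j)).
  do 2!(apply: Cr_sum => [|? _]; first exact: openT).
  by apply: CrZl; [exact: openT|move=> y _; exact: coord_continuous].
move=> C0; suff -> : l = (fun A => \sum_i \sum_j A i j *: l (delta_mx i j)).
  exact: C0.
rewrite funeqE => A; rewrite {1}[A]matrix_sum_delta -[l _]/(L _) linear_sum.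
by apply: eq_bigr => i _; rewrite linear_sum; apply: eq_bigr => j _; rewrite linearZ.
Qed.

Lemma Cr_linmx m p q (W : normedModType R) U (f : V -> 'M[R]_(p, q))
  (l : 'M[R]_(p, q) -> W) :
  open U -> linear l -> Cr m U f -> Cr m U (fun x => l (f x)).
Proof. by move=> oU ll; apply: Cr_lin => //; exact: linear_continuous_mx. Qed.

Lemma Cr_comp m q U (U' : set 'rV[R]_q) (f : 'rV[R]_q -> R) (g : V -> 'rV[R]_q) :
  open U -> open U' -> (forall x, U x -> U' (g x)) ->
  Cr m U' f -> Cr m U g -> Cr m U (fun x => f (g x)).
Proof.
move=> oU oU' gU; elim: m f => [|m IH] f.
  move=> Cf Cg x Ux; apply: continuous_comp; first exact: Cg.
  exact/Cf/gU.
move=> Cf Cg; have [df Df] := Cf; have [dg Dg] := Cg.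
split=> [x Ux|v]; first by apply: differentiable_comp; [exact: dg|exact/df/gU].
apply: (@Cr_eq _ _ _ _ _
  (fun x => \sum_i ('D_v g x) ord0 i * 'D_(delta_mx ord0 i) f (g x))) => //.
  move=> x Ux; have dfg := df _ (gU _ Ux).
  rewrite [RHS]deriveE; last by apply: differentiable_comp => //; exact: dg.
  rewrite (_ : (fun x => f (g x)) = f \o g)// diff_comp//; last exact: dg.
  rewrite /= -[in RHS](deriveE _ (dg _ Ux)).
  rewrite [in RHS](row_sum_delta ('D_v g x)) linear_sum; apply: eq_bigr => i _.
  by rewrite linearZ/= [in LHS](deriveE _ dfg).
apply: Cr_sum => // i _; apply: CrM => //; first by apply: Cr_coord => //; exact: Dg.
by apply: (IH ('D_(delta_mx ord0 i) f)); [exact: Df|exact: CrW].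
Qed.

End CrMatrix.

Lemma Cr_comp_mx (R : realType) (V : normedModType R) m p a b (U : set V)
    (U' : set 'rV[R]_p) (f : 'rV[R]_p -> 'M[R]_(a, b))
    (g : V -> 'rV[R]_p) :
  open U -> open U' -> (forall x, U x -> U' (g x)) ->
  Cr m U' f -> Cr m U g -> Cr m U (fun x => f (g x)).
Proof.
move=> oU oU' gU Cf Cg; apply: Cr_mx => // i j.
by apply: (Cr_comp (f := fun y => f y i j) oU oU' gU) => //; exact: Cr_coord.
Qed.

(** * Partial derivatives and smoothness *)

Section Partials.
Context {R : realType}.

Lemma normr_entry p q (M : 'M[R]_(p, q)) i j : `|M i j| <= `|M|.
Proof.
rewrite [leRHS]/Num.Def.normr /= mx_normrE.
exact: (le_bigmax _ (fun ij => `|M ij.1 ij.2|) (i, j)).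
Qed.

Lemma normr_mx_le p q (M : 'M[R]_(p, q)) c : 0 <= c ->
  (forall i j, `|M i j| <= c) -> `|M| <= c.
Proof.
move=> c0 Mc; rewrite [leLHS]/Num.Def.normr /= mx_normrE.
by apply: bigmax_le => // -[i j] _; exact: Mc.
Qed.

Lemma MVT_dev (phi : R -> R) (d e r : R) :
  (forall s, `|s| <= `|r| -> derivable phi s 1 /\ `|'D_1 phi s - d| <= e) ->
  `|phi r - phi 0 - d * r| <= e * `|r|.
Proof.
move=> H.
have key a b : a <= b -> `|a| <= `|r| -> `|b| <= `|r| ->
    `|phi b - phi a - d * (b - a)| <= e * (b - a).
  move=> ab ar br.
  have sr s : s \in `[a, b]%R -> `|s| <= `|r|.
    rewrite in_itv/= => /andP[as_ sb]; move: ar br; rewrite !ler_norml.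
    by move=> /andP[? ?] /andP[? ?]; apply/andP; split; lra.
  have [|||c cab ->] := @MVT_segment _ phi ('D_1 phi) a b => //.
  - move=> s /subset_itv_oo_cc sab; apply: DeriveDef => //.
    by have [] := H _ (sr _ sab).
  - apply: derivable_within_continuous => s sab.
    by have [] := H _ (sr _ sab).
  - rewrite -mulrBl normrM (ger0_norm (x := b - a)) ?subr_ge0//.
    apply: ler_wpM2r; first by rewrite subr_ge0.
    by have [] := H _ (sr _ cab).
have [r0|r0] := leP 0 r.
  by have := key 0 r r0; rewrite normr0 subr0 (ger0_norm r0); apply.
have := key r 0 (ltW r0); rewrite normr0 sub0r (ltr0_norm r0) => K.
rewrite -normrN (_ : - (phi r - phi 0 - d * r) = phi 0 - phi r - d * - r); last by ring.
by apply: K => //; rewrite oppr_ge0 ltW.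
Qed.

Lemma is_derive_line (V : normedModType R) (f : V -> R) p v s :
  derivable f (p + s *: v) v ->
  is_derive s 1 (fun t => f (p + t *: v)) ('D_v f (p + s *: v)).
Proof.
move=> df.
have E : (fun h : R => h^-1 *: (((fun t => f (p + t *: v)) \o shift s) (h *: 1)
     - f (p + s *: v))) =
   (fun h => h^-1 *: ((f \o shift (p + s *: v)) (h *: v) - f (p + s *: v))).
  rewrite funeqE => h /=; congr (_ *: (f _ - _)).
  by rewrite [h *: 1]mulr1 scalerDl addrCA.
by split; rewrite /derivable /derive E.
Qed.

Lemma C1_differentiable p (U : set 'rV[R]_p) (f : 'rV[R]_p -> R) x :
  open U -> U x -> (forall y, U y -> forall v, derivable f y v) ->
  (forall v, {for x, continuous ('D_v f)}) -> differentiable f x.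
Proof.
move=> oU Ux df cf.
pose e_ (i : 'I_p) : 'rV[R]_p := delta_mx ord0 i.
pose l (h : 'rV[R]_p) := \sum_i h ord0 i * 'D_(e_ i) f x.
have ll : linear l.
  move=> k A B; rewrite /l scaler_sumr -big_split; apply: eq_bigr => i _ /=.
  by rewrite !mxE mulrDl -[_ *: (_ * _)]/(_ * (_ * _)) mulrA.
pose lM := GRing.isLinear.Build _ _ _ _ l ll.
pose L : {linear 'rV[R]_p -> R} := HB.pack l lM.
have [] // := @eps_diff _ _ _ f x L; first exact: linear_continuous_mx.
move=> e e0; pose e' := e / p.+1%:R.
have e'0 : 0 < e' by rewrite divr_gt0.
have : \forall y \near x, U y /\ forall i, `|'D_(e_ i) f y - 'D_(e_ i) f x| <= e'.
  near=> y; split; first by near: y; exact: open_nbhs_nbhs.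
  near: y; apply: filter_forall => i.
  have := cf (e_ i) => /cvgrPdist_le /(_ _ e'0).
  by apply: filterS => y; rewrite distrC.
move=> /nbhs_ballP[d /= d0 dU].
apply/nbhs_ballP; exists d => // y; rewrite -ball_normE /= distrC => xy.
pose q j : 'rV[R]_p := \row_i (if (i < j)%N then y ord0 i else x ord0 i).
have key j : (j <= p)%N -> `|f (q j) - f x -
    \sum_(i < p | (i < j)%N) (y - x) ord0 i * 'D_(e_ i) f x| <=
    j%:R * e' * `|y - x|.
  elim: j => [_|j IH jp].
    rewrite big_pred0// (_ : q 0%N = x); last by apply/rowP => i; rewrite mxE.
    by rewrite !subrr normr0 !mul0r.
  pose J := Ordinal jp; pose r := (y - x) ord0 J.
  have rxy : `|r| <= `|y - x| by exact: normr_entry.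
  have qE : q j.+1 = q j + r *: e_ J.
    apply/rowP => i; rewrite !mxE /= -[i == J]/(i == j :> nat) ltnS leq_eqVlt.
    case: ltngtP => //= ij; rewrite ?mulr0 ?addr0 ?mulr1 //.
    have -> : i = J by exact/val_inj.
    by rewrite /r !mxE addrC subrK.
  have qU s : `|s| <= `|r| -> ball x d (q j + s *: e_ J).
    move=> sr; rewrite -ball_normE /= distrC; apply: le_lt_trans xy.
    apply: normr_mx_le => // a i; rewrite ord1 !mxE /= -[i == J]/(i == j :> nat).
    case: ltngtP => //= ij; rewrite ?mulr0 ?addr0 ?mulr1 ?subrr ?normr0 //.
      by have := normr_entry (y - x) ord0 i; rewrite !mxE.
    have -> : i = J by exact/val_inj.
    by rewrite addrC addKr; exact: le_trans sr rxy.
  have := @MVT_dev (fun s => f (q j + s *: e_ J)) ('D_(e_ J) f x) e' r.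
  rewrite scale0r addr0 -qE => M.
  have {M} M : `|f (q j.+1) - f (q j) - 'D_(e_ J) f x * r| <= e' * `|r|.
    apply: M => s sr; have [Uq Dq] := dU _ (qU _ sr).
    have [? ->] := is_derive_line (df _ Uq (e_ J)).
    by split=> //; exact: Dq.
  rewrite (bigD1 J) //= (eq_bigl (fun i : 'I_p => (i < j)%N)); last first.
    move=> i; rewrite -[i == J]/(i == j :> nat) ltnS.
    by case: ltngtP.
  have {}IH := IH (ltnW jp).
  set S := \sum_(i < p | _) _ in IH *.
  rewrite (_ : _ - _ = (f (q j) - f x - S) +
     (f (q j.+1) - f (q j) - 'D_(e_ J) f x * r)); last by rewrite -/r; lra.
  apply: le_trans (ler_normD _ _) _.
  rewrite -natr1 mulrDl mul1r mulrDl; apply: lerD => //.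
  by apply: le_trans M _; apply: ler_wpM2l => //; exact: ltW.
have := key p (leqnn p).
rewrite (_ : q p = y); last by apply/rowP => i; rewrite mxE ltn_ord.
rewrite (eq_bigl xpredT); last by move=> i; rewrite ltn_ord.
move=> /le_trans -> //; apply: ler_wpM2r => //.
rewrite /e' mulrCA ler_piMr ?ltW// ltr_pdivrMr// mul1r ltr_nat//.
Unshelve. all: by end_near. Qed.

Lemma smooth_on_derive (V W : normedModType R) (U : set V) (f : V -> W) v :
  smooth_on U f -> smooth_on U ('D_v f).
Proof.
move=> sf vs x Ux; have := sf (rcons vs v) x Ux.
by have -> : iderive f (rcons vs v) = iderive ('D_v f) vs by elim: vs => //= a s ->.
Qed.

Lemma smooth_on_coord (V : normedModType R) p q (U : set V)
    (f : V -> 'M[R]_(p, q)) i j :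
  open U -> smooth_on U f -> smooth_on U (fun x => f x i j).
Proof.
move=> oU sf.
have E vs x : U x -> iderive (fun x => f x i j) vs x = iderive f vs x i j.
  elim: vs x => //= v vs IH x Ux.
  have [dx _] := sf vs x Ux.
  by rewrite (near_eq_derive _ (near_open oU Ux IH)) derive_mx// mxE.
move=> vs x Ux; have [dx cx] := sf vs x Ux.
have nE : \forall y \near x, iderive f vs y i j = iderive (fun x => f x i j) vs y.
  by apply: near_open Ux _ => // y Uy; rewrite E.
split=> [v|].
  by apply: near_eq_derivable nE _; exact/(derivable_mxP _ _ _).1.
rewrite /prop_for /continuous_at E//.
apply: (cvg_trans (near_eq_cvg nE)).
exact: (continuous_comp cx (@coord_continuous _ _ _ i j _)).
Qed.

Lemma smooth_Cr_scalar p (U : set 'rV[R]_p) (f : 'rV[R]_p -> R) m :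
  open U -> smooth_on U f -> Cr m U f.
Proof.
move=> oU; elim: m f => [|m IH] f sf; first by move=> x Ux; have [] := sf [::] x Ux.
split=> [x Ux|v]; last exact/IH/smooth_on_derive.
apply: (C1_differentiable oU Ux) => [y Uy v|v]; first by have [] := sf [::] y Uy.
by have [_] := sf [:: v] x Ux.
Qed.

Lemma smooth_Cr p a b (U : set 'rV[R]_p) (f : 'rV[R]_p -> 'M[R]_(a, b)) m :
  open U -> smooth_on U f -> Cr m U f.
Proof.
move=> oU sf; apply: Cr_mx => // i j; apply: smooth_Cr_scalar => //.
exact: smooth_on_coord.
Qed.

End Partials.

(** * A smooth clamp *)

Section Flat.
Context {R : realType}.

Definition flat (j : nat) (x : R) : R :=
  if 0 < x then x ^- j * expR (- x^-1) else 0.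

Lemma flat_ge0 j x : 0 <= flat j x.
Proof.
rewrite /flat; case: ifP => // x0.
by rewrite mulr_ge0 ?expR_ge0// invr_ge0 exprn_ge0// ltW.
Qed.

Lemma flat_gt0 j x : 0 < x -> 0 < flat j x.
Proof. by move=> x0; rewrite /flat x0 mulr_gt0 ?expR_gt0// invr_gt0 exprn_gt0. Qed.

Lemma flat_le0 j x : x <= 0 -> flat j x = 0.
Proof. by move=> x0; rewrite /flat ltNge x0. Qed.

Lemma flat_le j x : flat j x <= (j.+2)`!%:R * x ^+ 2.
Proof.
have [x0|x0] := ltP 0 x; last by rewrite flat_le0// mulr_ge0// sqr_ge0.
have N0 : 0 < (j.+2)`!%:R :> R by rewrite ltr0n fact_gt0.
have le1 : (x ^+ j.+2 * (j.+2)`!%:R)^-1 <= expR x^-1.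
  rewrite invfM; apply: le_trans (expR_ge1Dxn j.+1 _); last by rewrite invr_ge0 ltW.
  by rewrite -exprVn lerDr.
rewrite /flat x0 expRN ler_pdivrMl ?exprn_gt0// mulrCA -exprD addn2 mulrC.
rewrite -[leRHS]invrK lef_pV2 ?posrE ?expR_gt0//.
by rewrite invr_gt0 mulr_gt0// exprn_gt0.
Qed.

Lemma is_derive_flat j (x : R) :
  is_derive x 1 (flat j : R -> R) (flat j.+2 x - j%:R * flat j.+1 x).
Proof.
have [x0|x0|->] := ltgtP x 0.
- rewrite !flat_le0 ?(ltW x0)// mulr0 subr0.
  apply: near_eq_is_derive (is_derive_cst (0 : R) x 1).
  by near=> y; rewrite flat_le0//; apply: ltW; near: y; exact: lt_nbhsl.
- have xn0 : x != 0 by rewrite gt_eqF.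
  have nE : \forall y \near x, (y ^+ j)^-1 * expR (- y^-1) = flat j y.
    near=> y; rewrite /flat ifT//; near: y; exact: lt_nbhsr.
  apply: near_eq_is_derive nE _.
  have dV : is_derive x 1 (fun y : R => y^-1) (- x ^- 2).
    apply: is_derive_eq; first exact: is_deriveV.
    by rewrite scaler1.
  have dE : is_derive x 1 (fun y => expR (- y^-1)) (x ^- 2 * expR (- x^-1)).
    rewrite (_ : _ * _ = expR (- x^-1) * - - x ^- 2); last by ring.
    have N := @is_deriveN R R R (fun y => y^-1) x 1 _ dV.
    have H := @is_derive1_comp R expR _ x _ _ (is_derive_expR (- x^-1)) N.
    exact: H.
  have dX : is_derive x 1 (fun y => (y ^+ j)^-1) (- j%:R * x ^- j.+1).
    case: (j) => [|i].
      rewrite oppr0 mul0r (_ : (fun y : R => _) = cst 1); first exact: is_derive_cst.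
      by rewrite funeqE => y; rewrite expr0 invr1.
    rewrite (_ : (fun y : R => _) = (fun y : R => y^-1) ^+ i.+1); last first.
      by rewrite funeqE => y; rewrite exprfctE exprVn.
    apply: (is_derive_eq (is_deriveX i.+1 dV)).
    have -> : x ^- i.+2 = x^-1 ^+ i * x ^- 2 by rewrite -!exprVn -exprD addn2.
    by rewrite /GRing.scale/=; ring.
  apply: (is_derive_eq (is_deriveM dX dE)).
  rewrite /flat x0 /GRing.scale/=.
  have x2 : x ^- j.+2 = x ^- j * x ^- 2 by rewrite -!exprVn -exprD addn2.
  by rewrite x2; ring.
- rewrite !flat_le0// mulr0 subr0.
  have [|e e0|df dE] := @eps_diff _ _ _ (flat j : R -> R) (0 : R) \0.
  + by move=> y; exact: cst_continuous.
  + have N0 : 0 < (j.+2)`!%:R :> R by rewrite ltr0n fact_gt0.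
    near=> y; rewrite (flat_le0 j (lexx 0)) !subr0 (ger0_norm (flat_ge0 _ _)).
    apply: le_trans (flat_le _ _) _.
    rewrite -real_normK ?num_real// expr2 mulrA; apply: ler_wpM2r => //.
    rewrite mulrC -ler_pdivlMr//; near: y.
    exact: (@nbhs0_le R R^o _ (divr_gt0 e0 N0)).
  + apply: DeriveDef; first exact: diff_derivable.
    by rewrite deriveE// dE.
Unshelve. all: by end_near.
Qed.

Lemma Cr_flat (V : normedModType R) m (U : set V) (f : V -> R) j :
  open U -> Cr m U f -> Cr m U (fun x => flat j (f x)).
Proof.
move=> oU; elim: m j => [|m IH] j.
  move=> Cf x Ux; apply: continuous_comp; first exact: Cf.
  apply: differentiable_continuous; apply/derivable1_diffP.
  by have [] := is_derive_flat j (f x).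
move=> Cf; have [df Df] := Cf.
have dF (y : R) : differentiable (flat j : R -> R) y.
  by apply/derivable1_diffP; have [] := is_derive_flat j y.
split=> [x Ux|v]; first by apply: differentiable_comp => //; exact: df.
have C2 := IH j.+2 (CrW Cf); have C1 := IH j.+1 (CrW Cf).
apply: Cr_eq (CrM oU (CrB oU C2 (CrMl j%:R oU C1)) (Df v)) => // x Ux.
rewrite [RHS]deriveE; last by apply: differentiable_comp => //; exact: df.
rewrite (_ : (fun x => _) = (flat j : R -> R) \o f)// diff_comp//; last exact: df.
rewrite /= -[in RHS](deriveE _ (df _ Ux)).
have dZ (r : R) : 'd (flat j : R -> R) (f x) r = r * 'D_1 (flat j : R -> R) (f x).
  by rewrite deriveE// -[in LHS](mulr1 r) -[r * 1]/(r *: (1 : R)) linearZ.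
rewrite dZ.
have [_ ->] := is_derive_flat j (f x).
by rewrite [RHS]mulrC.
Qed.

Definition clamp (s : R) : R :=
  s * (flat 0 (4 - s ^+ 2) / (flat 0 (4 - s ^+ 2) + flat 0 (s ^+ 2 - 1))).

Let clamp_den (s : R) : 0 < flat 0 (4 - s ^+ 2) + flat 0 (s ^+ 2 - 1).
Proof.
have [s2|s2] := ltP (s ^+ 2) 4.
  by apply: ltr_wpDr; [exact: flat_ge0|apply: flat_gt0; rewrite subr_gt0].
apply: ltr_wpDl; [exact: flat_ge0|apply: flat_gt0]; lra.
Qed.

Lemma Cr_clamp (V : normedModType R) m (U : set V) (f : V -> R) :
  open U -> Cr m U f -> Cr m U (fun x => clamp (f x)).
Proof.
move=> oU Cf; apply: CrM => //.
have C4 : Cr m U (fun x => flat 0 (4 - f x ^+ 2)).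
  by apply: Cr_flat => //; apply: CrB => //; [exact: Cr_cst|exact: CrX].
apply: CrM => //; apply: CrV => //; first by move=> x _; rewrite gt_eqF.
apply: CrD => //; apply: Cr_flat => //; apply: CrB => //; [exact: CrX|exact: Cr_cst].
Qed.

Lemma clamp_id s : `|s| <= 1 -> clamp s = s.
Proof.
move=> s1.
have g0 : flat 0 (s ^+ 2 - 1) = 0.
  by rewrite flat_le0// subr_le0 -real_normK ?num_real// expr_le1.
have := clamp_den s; rewrite /clamp g0 addr0 => /gt_eqF dn.
by rewrite divff ?dn// mulr1.
Qed.

Lemma clamp_out s : 2 <= `|s| -> clamp s = 0.
Proof.
move=> s2; rewrite /clamp flat_le0 ?mul0r ?mulr0// subr_le0 -real_normK ?num_real//.
by rewrite (_ : 4 = 2 ^+ 2) ?ler_sqr ?nnegrE// expr2 -natrM.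
Qed.

Lemma clamp_le2 s : `|clamp s| <= 2.
Proof.
have [s2|s2] := leP 2 `|s|; first by rewrite clamp_out// normr0.
rewrite /clamp normrM -[leRHS]mulr1; apply: ler_pM => //; first exact: ltW.
rewrite [leLHS]ger0_norm; last by rewrite divr_ge0 ?flat_ge0// ltW.
by rewrite ler_pdivrMr// mul1r lerDl flat_ge0.
Qed.

Lemma clamp_lipschitz :
  exists2 K : R, 0 < K & forall s t, `|clamp s - clamp t| <= K * `|s - t|.
Proof.
have C1 : Cr 1 setT (clamp : R -> R).
  apply: (@Cr_clamp _ _ _ id openT).
  apply: (@Cr_linear _ _ _ _ setT idfun openT) => x; exact: cvg_id.
have [dc Dc] := C1.
have cD : continuous ('D_1 (clamp : R -> R)) by move=> x; exact: Dc.
have out s : 2 < `|s| -> 'D_1 (clamp : R -> R) s = 0.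
  move=> s2; rewrite -(derive_cst (0 : R) s (1 : R)); apply: near_eq_derive.
  near=> y; apply: clamp_out; apply: ltW; near: y.
  by apply: (cvgr_gt `|s|) => //; exact: norm_continuous.
have le22 : (- 2 : R) <= 2 by lra.
pose D : R -> R := 'D_1 (clamp : R -> R).
have cN : continuous (fun s : R => `|D s|).
  by move=> x; apply: (continuous_comp (cD x)); exact: norm_continuous.
have [c _ Mc] := EVT_max le22 (continuous_subspaceT cN).
have cE s : `|'D_1 (clamp : R -> R) s| <= `|'D_1 (clamp : R -> R) c|.
  have [/out->|s2] := ltP 2 `|s|; first by rewrite normr0.
  by apply: Mc; rewrite in_itv/= -ler_norml.
exists (`|'D_1 (clamp : R -> R) c| + 1) => [|s t]; first by rewrite ltr_wpDl.
have := @MVT_dev R (fun r => clamp (t + r *: 1)) 0 (`|'D_1 (clamp : R -> R) c| + 1) (s - t).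
rewrite mul0r subr0 scale0r addr0 [_ *: 1]mulr1 [t + (s - t)]addrC subrK; apply=> r _.
have [|dr ->] := @is_derive_line R R (clamp : R -> R) t 1 r.
  by apply: diff_derivable; exact: dc.
by split=> //; rewrite subr0; apply: le_trans (cE _) _; rewrite lerDl.
Unshelve. all: by end_near. Qed.

End Flat.

(** * Inverse maps and quantitative estimates *)

Section Inverse.
Context {R : realType}.

Lemma mulmx_lipschitz p q r (B : 'M[R]_(q, r)) :
  exists2 C, 0 < C & forall A : 'M[R]_(p, q), `|A *m B| <= C * `|A|.
Proof.
have @l : {linear 'M[R]_(p, q) -> 'M[R]_(p, r)}.
  by exists (mulmxr B); exact: GRing.Linear.class.
exact: (linear_lipschitz (f := l) (linear_continuous_mx (linearP l))).
Qed.

Lemma deriv_lower (V W : normedModType R) (f : V -> W) x v m :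
  differentiable f x -> (forall h : R, m * `|h| <= `|f (x + h *: v) - f x|) ->
  m <= `|'d f x v|.
Proof.
move=> df fm; apply/ler_addgt0Pr => e e0.
have v1 : 0 < `|v| + 1 by rewrite ltr_wpDl.
have e'0 : 0 < e / (`|v| + 1) by rewrite divr_gt0.
have /nbhs_ballP[d /= d0 dP] := diff_eps df e'0.
pose h := d / 2 / (`|v| + 1).
have h0 : 0 < h by rewrite !divr_gt0.
have hv : `|h *: v| <= h * (`|v| + 1).
  by rewrite normrZ gtr0_norm// ler_pM2l// lerDl.
have /dP : ball x d (x + h *: v).
  rewrite -ball_normE /= opprD addNKr normrN; apply: le_lt_trans hv _.
  by rewrite /h divfK ?gt_eqF//; lra.
rewrite (addrC x (h *: v)) addrK linearZ => fh.
rewrite -(ler_pM2r h0) -[in leLHS](gtr0_norm h0); apply: le_trans (fm h) _.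
rewrite [x + _]addrC.
rewrite -[f _ - _](subrK (h *: 'd f x v)); apply: le_trans (ler_normD _ _) _.
have F : e / (`|v| + 1) * `|h *: v| <= e * h.
  by rewrite -mulrA ler_pM2l// ler_pdivrMl// mulrC.
have := le_trans fh F; rewrite normrZ (gtr0_norm h0); lra.
Qed.

Lemma inv_Cr n (H Psi : 'rV[R]_n -> 'rV[R]_n) :
  (forall m, Cr m setT H) -> (forall x, H (Psi x) = x) -> continuous Psi ->
  (forall z v, 'd H z v = 0 -> v = 0) -> forall m, Cr m setT Psi.
Proof.
move=> CH HK cP Hinj.
have dH z : differentiable H z by have [d _] := CH 1%N; exact: d.
pose J z : 'M[R]_n := lin1_mx ('d H z).
have JE z v : 'd H z v = v *m J z by rewrite mul_rV_lin1.
have Ju z : J z \in unitmx.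
  rewrite -row_free_unit -kermx_eq0; apply/eqP/row_matrixP => i.
  rewrite row0; apply: (Hinj z); rewrite JE.
  by apply/sub_kermxP; exact: row_sub.
have dP x : differentiable Psi x /\ forall v, 'd Psi x v = v *m invmx (J (Psi x)).
  set Ji := invmx (J (Psi x)).
  have [C C0 CP] := @mulmx_lipschitz 1 n n Ji.
  have @l : {linear 'rV[R]_n -> 'rV[R]_n}.
    by exists (mulmxr Ji); exact: GRing.Linear.class.
  have [||dPx dE] // := @eps_diff _ _ _ Psi x l.
  - exact: (linear_continuous_mx (linearP l)).
  - move=> e e0.
    pose e' := Num.min ((2 * C)^-1) (e / (2 * C ^+ 2)).
    have e'0 : 0 < e'.
      by rewrite lt_min invr_gt0 mulr_gt0//= divr_gt0// mulr_gt0// exprn_gt0.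
    have : \forall y \near x, `|H (Psi y) - H (Psi x) -
        'd H (Psi x) (Psi y - Psi x)| <= e' * `|Psi y - Psi x|.
      exact: (cP x _ (diff_eps (dH (Psi x)) e'0)).
    apply: filterS => y /=; rewrite !HK JE.
    set w := Psi y - Psi x => K.
    have K' : `|(y - x) *m Ji - w| <= C * e' * `|w|.
      rewrite (_ : _ - w = (y - x - w *m J (Psi x)) *m Ji).
        by apply: le_trans (CP _) _; rewrite -mulrA ler_pM2l.
      by rewrite [in RHS]mulmxBl /Ji mulmxK.
    have Ce : C * e' <= 2^-1.
      apply: le_trans (_ : C * (2 * C)^-1 <= _); first by rewrite ler_pM2l// ge_min lexx.
      by rewrite invfM mulrCA divff ?mulr1// gt_eqF.
    have w2 : `|w| <= 2 * C * `|y - x|.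
      have := ler_normB ((y - x) *m Ji) ((y - x) *m Ji - w).
      rewrite opprB addrC subrK => W.
      have W2 : C * e' * `|w| <= 2^-1 * `|w| by rewrite ler_wpM2r.
      have := CP (y - x); lra.
    rewrite distrC; apply: le_trans K' _.
    have Ce2 : C * e' * (2 * C) <= e.
      rewrite (_ : _ * _ * _ = e' * (2 * C ^+ 2)); last by ring.
      by rewrite -ler_pdivlMr ?ge_min ?lexx ?orbT// mulr_gt0// exprn_gt0.
    apply: le_trans (_ : C * e' * (2 * C * `|y - x|) <= _).
      by rewrite ler_pM2l// mulr_gt0.
    by rewrite mulrA ler_wpM2r.
  - by split=> // v; rewrite dE.
have CJ m : Cr m setT J.
  apply: Cr_mx => [|i j]; first exact: openT.
  apply: (@Cr_eq _ _ _ _ _ (fun z => 'D_(delta_mx ord0 i) H z ord0 j)) => [|x _|].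
  - exact: openT.
  - by rewrite deriveE// mxE.
  - by apply: Cr_coord; [exact: openT|have [_ D] := CH m.+1; exact: D].
elim=> [|m IH]; first by move=> x _; exact: cP.
split=> [x _|v]; first by have [] := dP x.
apply: (@Cr_eq _ _ _ _ _ (fun x => v *m invmx (J (Psi x)))) => [|x _|].
- exact: openT.
- by have [dx dE] := dP x; rewrite deriveE// dE.
- apply: Cr_mulmxl; first exact: openT.
  apply: Cr_invmx => [|x _|]; [exact: openT|exact: Ju|].
  by apply: (Cr_comp_mx (U' := setT)) => //; exact: openT.
Qed.

Lemma bilinear_lower p q r (beta : 'rV[R]_p -> 'rV[R]_q -> 'rV[R]_r) :
  (forall b, linear (beta^~ b)) -> (forall a, linear (beta a)) ->
  (forall a b, beta a b = 0 -> a = 0 \/ b = 0) ->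
  exists2 kappa, 0 < kappa & forall a b, kappa * `|a| * `|b| <= `|beta a b|.
Proof.
move=> ll lr ns.
have bZl k a b : beta (k *: a) b = k *: beta a b.
  pose M := GRing.isLinear.Build _ _ _ _ (beta^~ b) (ll b).
  pose L : {linear 'rV[R]_p -> 'rV[R]_r} := HB.pack (beta^~ b) M.
  exact: (linearZ_LR L).
have bZr k a b : beta a (k *: b) = k *: beta a b.
  pose M := GRing.isLinear.Build _ _ _ _ (beta a) (lr a).
  pose L : {linear 'rV[R]_q -> 'rV[R]_r} := HB.pack (beta a) M.
  exact: (linearZ_LR L).
pose f (w : 'rV[R]_(p + q)) := `|beta (lsubmx w) (rsubmx w)|.
pose S := [set w : 'rV[R]_(p + q) | `|lsubmx w| = 1 /\ `|rsubmx w| = 1].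
have C_l : Cr 0 setT (fun w : 'rV[R]_(p + q) => lsubmx w).
  by move=> w _; apply: linear_continuous_mx; exact: linearP.
have C_r : Cr 0 setT (fun w : 'rV[R]_(p + q) => rsubmx w).
  by move=> w _; apply: linear_continuous_mx; exact: linearP.
have betaE a b : beta a b = \sum_i \sum_j
    (a ord0 i * b ord0 j) *: beta (delta_mx ord0 i) (delta_mx ord0 j).
  pose M := GRing.isLinear.Build _ _ _ _ (beta^~ b) (ll b).
  pose L : {linear 'rV[R]_p -> 'rV[R]_r} := HB.pack (beta^~ b) M.
  rewrite {1}[a]row_sum_delta -[beta _ b]/(L _) linear_sum.
  apply: eq_bigr => i _; rewrite linearZ/= .
  pose M' := GRing.isLinear.Build _ _ _ _ (beta (delta_mx ord0 i)) (lr _).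
  pose L' : {linear 'rV[R]_q -> 'rV[R]_r} := HB.pack (beta (delta_mx ord0 i)) M'.
  rewrite {1}[b]row_sum_delta -[beta _ (\sum_i _)]/(L' _) linear_sum scaler_sumr.
  by apply: eq_bigr => j _; rewrite linearZ/= scalerA.
have cf : continuous f.
  have C0 : Cr 0 setT (fun w : 'rV[R]_(p + q) => beta (lsubmx w) (rsubmx w)).
    apply: (@Cr_eq _ _ _ _ _ (fun w => \sum_i \sum_j
      (lsubmx w ord0 i * rsubmx w ord0 j) *:
         beta (delta_mx ord0 i) (delta_mx ord0 j))) => [|w _|]; first exact: openT.
      by rewrite -betaE.
    do 2!(apply: Cr_sum => [|? _]; first exact: openT).
    apply: CrZl; first exact: openT.
    by apply: CrM; [exact: openT|..]; apply: Cr_coord => //; exact: openT.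
  by move=> w; apply: (continuous_comp (C0 w Logic.I)); exact: norm_continuous.
have [S0|/set0P/negP/negPn/eqP S0] := pselect (S !=set0); last first.
  exists 1 => // a b; rewrite mul1r.
  have [->|a0] := eqVneq a 0; first by rewrite normr0 mul0r.
  have [->|b0] := eqVneq b 0; first by rewrite normr0 mulr0.
  exfalso; have : S (row_mx (`|a|^-1 *: a) (`|b|^-1 *: b)).
    by rewrite /S /= row_mxKl row_mxKr !normrZ !normfV !normr_id !mulVf// normr_eq0.
  by rewrite S0.
have cS : compact S.
  apply: bounded_closed_compact.
    exists 1; split; first exact: num_real.
    move=> M M1 w [wl wr]; apply: normr_mx_le; first by lra.
    move=> i j; rewrite -[w]hsubmxK mxE; case: (fintype.split j) => l.
      by apply: le_trans (normr_entry _ _ _) _; rewrite wl ltW.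
    by apply: le_trans (normr_entry _ _ _) _; rewrite wr ltW.
  apply: closedI.
    apply: (@closed_comp _ _ (fun w : 'rV[R]_(p + q) => `|lsubmx w|) [set 1]).
      by move=> w _; apply: (continuous_comp (C_l w Logic.I)); exact: norm_continuous.
    exact: closed_eq.
  apply: (@closed_comp _ _ (fun w : 'rV[R]_(p + q) => `|rsubmx w|) [set 1]).
    by move=> w _; apply: (continuous_comp (C_r w Logic.I)); exact: norm_continuous.
  exact: closed_eq.
have [w wS wmin] := EVT_min_rV S0 cS (continuous_subspaceT cf).
have fw0 : 0 < f w.
  rewrite lt_neqAle normr_ge0 andbT eq_sym normr_eq0; apply/eqP => /ns.
  move: wS; rewrite inE => -[wl wr] [] E.
    by move: wl; rewrite E normr0 => /esym/eqP; rewrite oner_eq0.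
  by move: wr; rewrite E normr0 => /esym/eqP; rewrite oner_eq0.
exists (f w) => // a b.
have [->|a0] := eqVneq a 0; first by rewrite normr0 mulr0 mul0r.
have [->|b0] := eqVneq b 0; first by rewrite normr0 mulr0.
have na : 0 < `|a| by rewrite normr_gt0.
have nb : 0 < `|b| by rewrite normr_gt0.
have := wmin (row_mx (`|a|^-1 *: a) (`|b|^-1 *: b)).
rewrite {2}/f row_mxKl row_mxKr bZl bZr !normrZ !normfV !normr_id.
rewrite -!ler_pdivlMr// [_ / `|a|]mulrC [_ / `|b|]mulrC; apply.
by rewrite inE /S /= row_mxKl row_mxKr !normrZ !normfV !normr_id !mulVf// normr_eq0.
Qed.

Lemma lipschitz_small p a b (U : set 'rV[R]_p) (f : 'rV[R]_p -> 'M[R]_(a, b)) x :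
  open U -> U x -> Cr 1 U f -> (forall v, 'D_v f x = 0) ->
  forall e : R, 0 < e -> exists2 r, 0 < r & ball x r `<=` U /\
    forall y y', ball x r y -> ball x r y' -> `|f y - f y'| <= e * `|y - y'|.
Proof.
move=> oU Ux Cf D0 e e0; have [df Df] := Cf.
pose e' := e / p.+1%:R.
have e'0 : 0 < e' by rewrite divr_gt0.
have : \forall y \near x, U y /\ forall i : 'I_p, `|'D_(delta_mx ord0 i) f y| <= e'.
  near=> y; split; first by near: y; exact: open_nbhs_nbhs.
  near: y; apply: filter_forall => i.
  have /cvgrPdist_le /(_ _ e'0) := Df (delta_mx ord0 i) x Ux.
  by apply: filterS => y; rewrite D0 sub0r normrN.
move=> /nbhs_ballP[d /= d0 dU].
have bd y : ball x d y -> forall v i j, `|'D_v (fun z => f z i j) y| <= e * `|v|.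
  move=> /dU[Uy Dy] v i j.
  have -> : 'D_v (fun z => f z i j) y = 'D_v f y i j.
    by rewrite derive_mx ?mxE//; apply/diff_derivable/df.
  apply: le_trans (normr_entry _ _ _) _.
  rewrite deriveE; last exact: df.
  rewrite [v in leLHS]row_sum_delta linear_sum.
  apply: le_trans (ler_norm_sum _ _ _) _.
  apply: le_trans (_ : \sum_(l < p) `|v| * e' <= _).
    apply: ler_sum => l _; rewrite linearZ/= normrZ; apply: ler_pM => //.
      exact: normr_entry.
    by rewrite -deriveE//; exact: df.
  rewrite sumr_const card_ord -mulr_natr -mulrA mulrC ler_wpM2r// /e'.
  by rewrite -mulrA ler_piMr ?ltW// ltr_pdivrMl// mulr1 ltr_nat.
exists (d / 3); first by rewrite divr_gt0.
split=> [y yd|y y' yd yd'].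
  have /dU[] // : ball x d y by apply: le_ball yd; lra.
apply: normr_mx_le => [|i j]; first by rewrite mulr_ge0// ltW.
have := @MVT_dev R (fun s => f (y' + s *: (y - y')) i j) 0 (e * `|y - y'|) 1.
rewrite scale1r scale0r addr0 mul0r subr0 normr1 mulr1 [y' + (y - y')]addrC subrK !mxE; apply.
move=> s s1; have bs : ball x d (y' + s *: (y - y')).
  move: yd yd'; rewrite -!ball_normE/= => yd yd'.
  have : `|s *: (y - y')| <= `|y - y'| by rewrite normrZ ler_piMl.
  have : `|y - y'| <= `|x - y| + `|x - y'|.
    by rewrite [`|x - y|]distrC; exact: ler_distD.
  have : `|x - (y' + s *: (y - y'))| <= `|x - y'| + `|s *: (y - y')|.
    by rewrite opprD addrA; exact: ler_normB.
  lra.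
have [|? ->] := @is_derive_line R _ (fun z => f z i j) y' (y - y') s.
  apply: (derivable_mxP _ _ _).1; apply/diff_derivable/df.
  by have [] := dU _ bs.
by split=> //; rewrite subr0; exact: bd.
Unshelve. all: by end_near. Qed.

Definition clampv q (e : R) (b : 'rV[R]_q) : 'rV[R]_q :=
  \row_i (e * clamp (e^-1 * b ord0 i)).

Lemma Cr_clampv q m e : Cr m setT (@clampv q e).
Proof.
apply: Cr_mx => [|i j]; first exact: openT.
apply: (@Cr_eq _ _ _ _ _ (fun b : 'rV[R]_q => e * clamp (e^-1 * b ord0 j))) => [|x _|].
- exact: openT.
- by rewrite mxE.
apply: CrMl; first exact: openT.
apply: Cr_clamp; first exact: openT.
apply: CrMl; first exact: openT.
apply: (@Cr_coord _ _ _ _ _ _ idfun); first exact: openT.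
by apply: (@Cr_linear _ _ _ _ setT idfun openT) => x; exact: cvg_id.
Qed.

Lemma clampv_id q e (b : 'rV[R]_q) : 0 < e -> `|b| <= e -> clampv e b = b.
Proof.
move=> e0 be; apply/rowP => i; rewrite mxE clamp_id.
  by rewrite mulrA divff ?mul1r// gt_eqF.
rewrite normrM normfV (gtr0_norm e0) ler_pdivrMl// mulr1.
exact: le_trans (normr_entry _ _ _) be.
Qed.

Lemma clampv_le q e (b : 'rV[R]_q) : 0 < e -> `|clampv e b| <= 2 * e.
Proof.
move=> e0; apply: normr_mx_le => [|i j]; first by rewrite mulr_ge0// ltW.
by rewrite mxE normrM (gtr0_norm e0) mulrC ler_pM2r// clamp_le2.
Qed.

Lemma clampv_lipschitz : exists2 K : R, 0 < K & forall q e (b b' : 'rV[R]_q),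
  0 < e -> `|clampv e b - clampv e b'| <= K * `|b - b'|.
Proof.
have [K K0 KP] := @clamp_lipschitz R; exists K => // q e b b' e0.
apply: normr_mx_le => [|i j]; first by rewrite mulr_ge0// ltW.
rewrite !mxE -mulrBr normrM (gtr0_norm e0).
rewrite -ler_pdivlMl//; apply: le_trans (KP _ _) _.
rewrite -mulrBr normrM normfV (gtr0_norm e0) mulrCA ler_pM2l ?invr_gt0//.
rewrite ler_pM2l//; have := normr_entry (b - b') ord0 j.
by rewrite !mxE.
Qed.

End Inverse.

(** * The global slice coordinate *)

HB.instance Definition _ (R : realType) n := Complete.on 'rV[R]_n.

Lemma contraction_fixpoint (R : realType) n (T : 'rV[R]_n -> 'rV[R]_n) (c : R) :
  0 <= c < 1 -> (forall x y, `|T x - T y| <= c * `|x - y|) -> exists x, T x = x.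
Proof.
move=> /andP[c0 c1] Tc.
have fT : set_fun setT setT T by [].
pose TM := isFun.Build _ _ setT setT T fT.
pose F : {fun [set: 'rV[R]_n] >-> [set: 'rV[R]_n]} := HB.pack T TM.
have ctr : is_contraction F.
  by exists (NngNum c0); split=> // -[x y] _; exact: Tc.
have [x _ xE] := banach_fixed_point ctr closedT (ex_intro _ 0 Logic.I).
by exists x.
Qed.

Section GlobalMap.
Context {R : realType} {k q n : nat}.
Variables (A : 'M[R]_(k, n)) (B : 'M[R]_(q, n)).
Variables (PA : 'M[R]_(n, k)) (PB : 'M[R]_(n, q)).
Hypotheses (APA : A *m PA = 1%:M) (BPB : B *m PB = 1%:M).
Hypotheses (APB : A *m PB = 0) (BPA : B *m PA = 0).
Hypothesis (PAB : PA *m A + PB *m B = 1%:M).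
Variables (L : 'rV[R]_q -> 'M[R]_(k, q)) (D : {linear 'rV[R]_q -> 'M[R]_(k, q)}).
Variable (kappa : R).
Hypothesis CL : forall m, Cr m setT L.
Hypothesis kappa0 : 0 < kappa.
Hypothesis D1 : forall (c : 'rV[R]_k) (b : 'rV[R]_q), kappa * `|b| <= `|b + c *m D b|.
Hypothesis Dc : forall (c : 'rV[R]_k) (b : 'rV[R]_q), kappa * `|c| * `|b| <= `|b + c *m D b|.
Hypothesis D0 : forall (c : 'rV[R]_k) (b : 'rV[R]_q), kappa * `|c| * `|b| <= `|c *m D b|.
Hypothesis LD : forall (c : 'rV[R]_k) (b b' : 'rV[R]_q),
  `|c *m (L b - L b' - D (b - b'))| <= kappa / 2 * `|c| * `|b - b'|.

Lemma graph_map_lower c b b' :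
  kappa / 2 * `|b - b'| <= `|b + c *m L b - (b' + c *m L b')|.
Proof.
set w := b - b'.
rewrite (_ : b + _ - _ = w + c *m D w - - (c *m (L b - L b' - D w))); last first.
  rewrite !mulmxBr /w; move: (c *m _) (c *m _) (c *m _) => p p' d.
  by apply/rowP => j; rewrite !mxE; ring.
have := lerB_dist (w + c *m D w) (- (c *m (L b - L b' - D w))).
rewrite normrN => /(le_trans _); apply.
have := LD c b b'; rewrite -/w.
have := D1 c w; have := Dc c w.
have [c1|c1] := leP `|c| 1.
  have : `|c| * `|w| <= `|w| by rewrite ler_piMl.
  have : kappa * (`|c| * `|w|) <= kappa * `|w| by rewrite ler_pM2l// ler_piMl.
  lra.
have : kappa * `|w| <= kappa * (`|c| * `|w|) by rewrite ler_pM2l// ler_peMl// ltW.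
lra.
Qed.

Lemma graph_map_inj c b b' : b + c *m L b = b' + c *m L b' -> b = b'.
Proof.
move=> E; have := graph_map_lower c b b'.
rewrite E subrr normr0 pmulr_rle0 ?divr_gt0// normr_le0.
by move=> /eqP/subr0_eq.
Qed.

Lemma graph_map_surj c y : exists b, b + c *m L b = y.
Proof.
pose f b := b + c *m D b.
have lf : linear f.
  by move=> a u v; rewrite /f linearP mulmxDr scalerDr -scalemxAr addrACA.
pose M := GRing.isLinear.Build _ _ _ _ f lf.
pose F : {linear 'rV[R]_q -> 'rV[R]_q} := HB.pack f M.
have FE b : b *m lin1_mx F = b + c *m D b by rewrite mul_rV_lin1.
have Fu : lin1_mx F \in unitmx.
  rewrite -row_free_unit -kermx_eq0; apply/eqP/row_matrixP => i.
  rewrite row0; have /sub_kermxP := row_sub i (kermx (lin1_mx F)).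
  rewrite FE => E; have := D1 c (row i (kermx (lin1_mx F))).
  by rewrite E normr0 pmulr_rle0// normr_le0 => /eqP.
pose T b := (y - c *m (L b - D b)) *m invmx (lin1_mx F).
have [||b bE] := @contraction_fixpoint R q T 2^-1.
- by rewrite invr_ge0 ler0n invf_lt1 ?ltr1n.
- move=> b b'; set u := T b - T b'.
  have uE : u + c *m D u = - (c *m (L b - L b' - D (b - b'))).
    rewrite -FE /u /T -mulmxBl mulmxKV// (linearB D) !mulmxBr.
    move: (c *m _) (c *m _) (c *m _) (c *m _) => p1 p2 p3 p4.
    by apply/rowP => j; rewrite !mxE; ring.
  have := LD c b b'; have := D1 c u; have := Dc c u; rewrite uE normrN.
  move=> /[swap] H1 /[swap] /[dup] /(le_trans H1) {}H1 H3 /le_trans/(_ H3) H2.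
  have [c1|c1] := leP `|c| 1.
    have : kappa * (`|c| * `|b - b'|) <= kappa * `|b - b'|.
      by rewrite ler_pM2l// ler_piMl.
    move=> H4; rewrite -(ler_pM2l kappa0); lra.
  have c0 : 0 < `|c| by lra.
  rewrite -(ler_pM2l c0) -(ler_pM2l kappa0); lra.
exists b; have := congr1 (mulmx^~ (lin1_mx F)) bE; rewrite /T mulmxKV// FE.
rewrite mulmxBr; move: (c *m L b) (c *m D b) => p1 p2 E.
rewrite -[y](subrK (p1 - p2)) E; apply/rowP => j; rewrite !mxE; ring.
Qed.

Lemma slice_coordinate : exists beta : 'rV[R]_n -> 'rV[R]_q,
  (forall m, Cr m setT beta) /\
  (forall x, beta x + (x *m PA) *m L (beta x) = x *m PB).
Proof.
have [beta betaE] : exists beta : 'rV[R]_n -> 'rV[R]_q,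
    forall x, beta x + (x *m PA) *m L (beta x) = x *m PB.
  exists (fun x => sval (cid (graph_map_surj (x *m PA) (x *m PB)))) => x.
  by case: cid.
have oT (V : normedModType R) : open [set: V] by exact: openT.
have Cid m : Cr m setT (fun x : 'rV[R]_n => x).
  by apply: (@Cr_linear _ _ _ m setT idfun) => // x; exact: cvg_id.
have C0beta : Cr 0 setT beta.
  move=> x _.
  have [C C0 CP] := @mulmx_lipschitz R 1 _ _ (PB - PA *m L (beta x)).
  have H y : `|beta x - beta y| <= 2 * C / kappa * `|x - y|.
    have := graph_map_lower (y *m PA) (beta x) (beta y).
    rewrite betaE (distrC (beta x + _)).
    rewrite (_ : y *m PB - _ = (y - x) *m (PB - PA *m L (beta x))); last first.
      rewrite mulmxBr mulmxA !mulmxBl -(betaE x).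
      by apply/rowP => j; rewrite !mxE; ring.
    move=> /le_trans/(_ (CP _)).
    rewrite (distrC y x) => Hk.
    rewrite mulrAC ler_pdivlMr//; lra.
  suff H0 : beta @ nbhs x --> beta x by exact: H0.
  apply: (cvgrPdist_le _ _).2 => e e0.
  have K0 : 0 < 2 * C / kappa by rewrite divr_gt0// mulr_gt0.
  apply/nbhs_ballP; exists (e / (2 * C / kappa)); first by rewrite /= divr_gt0.
  move=> y; rewrite -ball_normE /= => xy.
  apply: le_trans (H y) _.
  by rewrite mulrC -ler_pdivlMr// ltW.
pose H z := z + (z *m PA) *m L (z *m PB) *m B.
pose Psi x := (x *m PA) *m A + beta x *m B.
have PsiA x : Psi x *m PA = x *m PA.
  by rewrite mulmxDl -!mulmxA APA BPA !mulmx0 addr0 mulmx1.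
have PsiB x : Psi x *m PB = beta x.
  by rewrite mulmxDl -!mulmxA APB BPB !mulmx0 add0r mulmx1.
have HA z : H z *m PA = z *m PA.
  by rewrite mulmxDl -!mulmxA BPA !mulmx0 addr0.
have HB z : H z *m PB = z *m PB + (z *m PA) *m L (z *m PB).
  by rewrite mulmxDl -!mulmxA BPB mulmx1.
have HK x : H (Psi x) = x.
  rewrite /H PsiA PsiB -addrA -mulmxDl betaE -!mulmxA -mulmxDr PAB.
  exact: mulmx1.
have CH m : Cr m setT H.
  apply: CrD => //; apply: Cr_mulmxr => //; apply: Cr_mulmx => //.
    by apply: Cr_mulmxr.
  by apply: (Cr_comp_mx (U' := setT)) => //; [exact: openT|apply: Cr_mulmxr].
have CbP m : Cr m setT beta -> Cr m setT Psi.
  by move=> Cb; apply: CrD => //; apply: Cr_mulmxr => //; apply: Cr_mulmxr.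
have CPsi : forall m, Cr m setT Psi.
  apply: (inv_Cr CH HK).
    move=> x; suff C0 : Cr 0 setT Psi by exact: C0.
    exact: CbP C0beta.
  move=> z v dv.
  have dH : differentiable H z by have [d _] := CH 1%N; exact: d.
  have vA : v *m PA = 0.
    have [C C0 CP] := @mulmx_lipschitz R 1 _ _ PA.
    have := @deriv_lower _ _ _ H z v (`|v *m PA| / C) dH.
    rewrite dv normr0 pmulr_lle0 ?invr_gt0// normr_le0 => W.
    apply/eqP/W => h.
    have := CP (H (z + h *: v) - H z).
    rewrite mulmxBl !HA mulmxDl [_ + _ - _]addrC addKr -scalemxAl normrZ => CPh.
    by rewrite mulrAC ler_pdivrMr// mulrC [leRHS]mulrC.
  have vB : v *m PB = 0.
    have [C C0 CP] := @mulmx_lipschitz R 1 _ _ PB.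
    have := @deriv_lower _ _ _ H z v (kappa / 2 * `|v *m PB| / C) dH.
    rewrite dv normr0 pmulr_lle0 ?invr_gt0// pmulr_rle0 ?divr_gt0// normr_le0 => W.
    apply/eqP/W => h.
    have := CP (H (z + h *: v) - H z).
    rewrite mulmxBl !HB (mulmxDl z _ PA) -scalemxAl vA scaler0 addr0 => CPh.
    have := graph_map_lower (z *m PA) ((z + h *: v) *m PB) (z *m PB).
    rewrite -mulmxBl [z + _ - z]addrC addKr -scalemxAl normrZ => /le_trans/(_ CPh) W'.
    rewrite mulrAC ler_pdivrMr// [leRHS]mulrC; lra.
  by rewrite -[v]mulmx1 -PAB mulmxDr !mulmxA vA vB !mul0mx addr0.
exists beta; split=> // m.
apply: Cr_eq (Cr_mulmxr PB _ (CPsi m)) => // x _.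
Qed.

Lemma deriv_graph_inj (c : 'rV[R]_k) (b v : 'rV[R]_q) : c *m 'D_v L b = 0 -> c = 0 \/ v = 0.
Proof.
move=> E.
have dL : differentiable L b by have [d _] := CL 1%N; exact: d.
have @l : {linear 'M[R]_(k, q) -> 'rV[R]_q}.
  by exists (mulmx c); exact: GRing.Linear.class.
have dl M : differentiable l M.
  by apply: linear_differentiable; exact: (linear_continuous_mx (linearP l)).
have dcL : differentiable (l \o L) b by exact: differentiable_comp.
have := @deriv_lower _ _ _ (l \o L) b v (kappa / 2 * `|c| * `|v|) dcL.
rewrite diff_comp//= diff_lin; last exact: (linear_continuous_mx (linearP l)).
rewrite -deriveE// (_ : l ('D_v L b) = 0)// normr0 -mulrA pmulr_rle0 ?divr_gt0// => W.
have : `|c| * `|v| <= 0.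
  apply: W => h.
  have := LD c (b + h *: v) b; rewrite (addrC b) addrK => H1.
  have := D0 c (h *: v); move: H1.
  rewrite !mulmxBr -[l _ - l _]/(c *m _ - c *m _) normrZ => H1 H2.
  have := lerB_dist (c *m D (h *: v)) (c *m L (h *: v + b) - c *m L b).
  rewrite distrC => H3; lra.
move=> cv; have : `|c| * `|v| == 0 by rewrite eq_le cv mulr_ge0.
rewrite mulf_eq0 !normr_eq0.
by move=> /orP[] /eqP; [left|right].
Qed.

End GlobalMap.

(** * The model fibration *)

Section MatrixDerive.
Context {R : realType} {V : normedModType R}.

Lemma is_derive_mx p q (f : V -> 'M[R]_(p, q)) x v (df : 'M[R]_(p, q)) :
  (forall i j, is_derive x v (fun y => f y i j) (df i j)) -> is_derive x v f df.
Proof.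
move=> H; have d : derivable f x v.
  by apply: (derivable_mxP _ _ _).2 => i j; have [] := H i j.
split=> //; rewrite derive_mx//; apply/matrixP => i j; rewrite mxE.
by have [_ ->] := H i j.
Qed.

Lemma is_derive_coord p q (f : V -> 'M[R]_(p, q)) x v (df : 'M[R]_(p, q)) :
  is_derive x v f df -> forall i j, is_derive x v (fun y => f y i j) (df i j).
Proof.
move=> [d dE] i j; split; first exact: (derivable_mxP _ _ _).1.
by rewrite -dE derive_mx// mxE.
Qed.

Lemma is_derive_mulmx p q r (f : V -> 'M[R]_(p, q)) (g : V -> 'M[R]_(q, r))
    x v (df : 'M[R]_(p, q)) (dg : 'M[R]_(q, r)) :
  is_derive x v f df -> is_derive x v g dg ->
  is_derive x v (fun y => f y *m g y) (df *m g x + f x *m dg).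
Proof.
move=> /is_derive_coord Df /is_derive_coord Dg; apply: is_derive_mx => i j.
pose h (l : 'I_q) : V -> R := fun y => f y i l * g y l j.
rewrite (_ : (fun y => _) = \sum_(l < q) h l); last first.
  by rewrite funeqE => y; rewrite mxE fct_sumE.
rewrite !mxE -big_split; apply: is_derive_sum => l.
apply: (is_derive_eq (is_deriveM (Df i l) (Dg l j))).
by rewrite addrC /GRing.scale/= [g _ _ _ * _]mulrC.
Qed.

Lemma Cr_derivable m p q (U : set V) (f : V -> 'M[R]_(p, q)) x v :
  Cr m.+1 U f -> U x -> is_derive x v f ('D_v f x).
Proof. by move=> [df _] Ux; split=> //; apply/diff_derivable/df. Qed.

Lemma Cr_pair m p q p' q' (U : set V) (f : V -> 'M[R]_(p, q)) (g : V -> 'M[R]_(p', q')) :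
  open U -> Cr m U f -> Cr m U g -> Cr m U (fun x => (f x, g x)).
Proof.
move=> oU Cf Cg; apply: (@Cr_eq _ _ _ _ _ (fun x => (f x, 0) + (0, g x))) => //.
  by move=> x _; rewrite -[LHS]/(_ + _, _ + _) /= addr0 add0r.
apply: CrD => //.
  apply: (Cr_linmx (l := fun a => (a, 0) : 'M[R]_(p, q) * 'M[R]_(p', q'))) => //.
  by move=> a u w; congr pair; rewrite /= scaler0 addr0.
apply: (Cr_linmx (l := fun a => (0, a) : 'M[R]_(p, q) * 'M[R]_(p', q'))) => //.
by move=> a u w; congr pair; rewrite /= scaler0 addr0.
Qed.

End MatrixDerive.

Section Frames.
Context {R : realType} {k n : nat}.

Lemma frame_equiv_refl (A : 'M[R]_(k, n)) : frame_equiv A A.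
Proof. by exists 1%:M; rewrite det1 ltr01 mul1mx. Qed.

Lemma frame_equiv_sym (A B : 'M[R]_(k, n)) : frame_equiv A B -> frame_equiv B A.
Proof.
move=> [M [M0 ->]]; exists (invmx M); rewrite det_inv invr_gt0 M0; split=> //.
by rewrite mulKmx// unitmxE unitfE gt_eqF.
Qed.

Lemma frame_equiv_trans (A B C : 'M[R]_(k, n)) :
  frame_equiv A B -> frame_equiv B C -> frame_equiv A C.
Proof.
move=> [M [M0 ->]] [N [N0 ->]]; exists (N *m M).
by rewrite det_mulmx mulr_gt0// mulmxA.
Qed.

Lemma gram_unit (A : 'M[R]_(k, n)) : row_free A -> A *m A^T \in unitmx.
Proof.
move=> fA; rewrite -row_free_unit -kermx_eq0; apply/eqP/row_matrixP => i.
rewrite row0; have /sub_kermxP := row_sub i (kermx (A *m A^T)).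
set v := row i _ => vA.
have : (v *m A) *m (v *m A)^T = 0.
  by rewrite trmx_mul mulmxA -(mulmxA v) vA mul0mx.
move=> /matrixP/(_ ord0 ord0); rewrite !mxE => /eqP.
rewrite psumr_eq0; last by move=> j _; rewrite !mxE -expr2 sqr_ge0.
move=> /allP Z; apply/eqP; rewrite -(mulmx_free_eq0 v fA); apply/eqP/rowP => j.
have := Z j; rewrite mem_index_enum => /(_ isT) /=.
by rewrite [(_ ^T) _ _]mxE mulf_eq0 orbb => /eqP ->; rewrite mxE.
Qed.

End Frames.

Section Model.
Context {R : realType} {k n : nat}.
Notation q := (n - k)%N.
Variables (A : 'M[R]_(k, n)) (B : 'M[R]_(q, n)).
Variables (PA : 'M[R]_(n, k)) (PB : 'M[R]_(n, q)).
Hypotheses (APA : A *m PA = 1%:M) (BPB : B *m PB = 1%:M).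
Hypotheses (APB : A *m PB = 0) (BPA : B *m PA = 0).
Hypothesis (PAB : PA *m A + PB *m B = 1%:M).
Variables (L : 'rV[R]_q -> 'M[R]_(k, q)) (beta : 'rV[R]_n -> 'rV[R]_q) (x0 : 'rV[R]_n).
Hypothesis CL : forall m, Cr m setT L.
Hypothesis Cbeta : forall m, Cr m setT beta.
Hypothesis betaE : forall x, beta x + (x *m PA) *m L (beta x) = x *m PB.
Hypothesis inj : forall c b b', b + c *m L b = b' + c *m L b' -> b = b'.
Hypothesis dinj : forall (c : 'rV[R]_k) b v, c *m 'D_v L b = 0 -> c = 0 \/ v = 0.

Let W b := A + L b *m B.
Let G x := W (beta (x - x0)).

Let oT (V : normedModType R) : open [set: V].
Proof. exact: openT. Qed.

Lemma slice_eq z b : z *m PB = b + (z *m PA) *m L b -> beta z = b.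
Proof. by move=> E; apply: (@inj (z *m PA)); rewrite betaE. Qed.

Lemma W_PA b : W b *m PA = 1%:M.
Proof. by rewrite mulmxDl -mulmxA BPA mulmx0 addr0. Qed.

Lemma W_PB b : W b *m PB = L b.
Proof. by rewrite mulmxDl -mulmxA BPB mulmx1 APB add0r. Qed.

Let GPA y : G y *m PA = 1%:M. Proof. exact: W_PA. Qed.

Let GPB y : G y *m PB = L (beta (y - x0)). Proof. exact: W_PB. Qed.

Lemma W_free b : row_free (W b).
Proof. by apply/row_freeP; exists PA; exact: W_PA. Qed.

Lemma beta_fiber x y : fiber G x y -> beta (y - x0) = beta (x - x0).
Proof.
move=> [c ->]; apply: slice_eq.
rewrite addrAC !(mulmxDl (x - x0)) -!mulmxA W_PA W_PB mulmx1 -betaE.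
by rewrite mulmxDl addrA.
Qed.

Lemma Cr_slice m : Cr m setT (fun y => beta (y - x0)).
Proof.
apply: (Cr_comp_mx (oT _) (oT _) _ (Cbeta m)) => //.
apply: CrD; [exact: oT| |exact: Cr_cst].
by apply: (@Cr_linear _ _ _ m setT idfun) => // y; exact: cvg_id.
Qed.

Lemma Cr_model m : Cr m setT G.
Proof.
have CLb : Cr m setT (fun x => L (beta (x - x0))).
  exact: (Cr_comp_mx (oT _) (oT _) _ (CL m) (Cr_slice m)).
apply: CrD; [exact: oT|exact: Cr_cst|].
by apply: Cr_mulmxr.
Qed.

Lemma model_nondegenerate : Defs.nondegenerate setT G.
Proof.
move=> x _.
pose Q := G x *m (G x)^T.
have Qu : Q \in unitmx by exact/gram_unit/W_free.
pose S y := G y *m (G x)^T.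
have CS m : Cr m setT S by apply: Cr_mulmxr => //; exact: Cr_model.
pose U := [set y | 0 < \det (S y) * \det Q].
have oU : open U.
  have C0 : Cr 0 setT (fun y => \det (S y) * \det Q).
    apply: CrM; [exact: oT| |exact: Cr_cst].
    by apply: Cr_det; [exact: oT|exact: CS].
  have -> : U = (fun y => \det (S y) * \det Q) @^-1` [set r | 0 < r] by [].
  apply: open_comp; last exact: open_gt.
  by move=> y _; exact: C0.
have Ux : U x.
  by rewrite /U /= -expr2 exprn_even_gt0//= -unitfE -unitmxE.
have SU y : U y -> S y \in unitmx.
  rewrite /U /= => Uy; rewrite unitmxE unitfE; apply/eqP => E.
  by move: Uy; rewrite E mul0r ltxx.
pose N y := Q *m invmx (S y).
pose Lf y := (G x)^T *m invmx Q *m (N y *m G y - G x).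
have GLf y : G x *m Lf y = N y *m G y - G x.
  by rewrite /Lf !mulmxA mulmxV// mul1mx.
have CLf m : Cr m U Lf.
  apply: Cr_mulmxl => //; apply: CrD => //; last exact: Cr_cst.
  apply: Cr_mulmx => //; last exact: Cr_sub (Cr_model m).
  by apply: Cr_mulmxl => //; apply: Cr_invmx => //; exact: Cr_sub (CS m).
exists U, Lf; split=> // [y Uy _|xi t pxi xi0 /submxP[tau tE] t0].
  split.
    by rewrite GLf mulmxBl /N -!mulmxA -/(S y) mulVmx ?SU// mulmx1 subrr.
  rewrite GLf addrC subrK; exists (invmx (N y)).
  have detN : 0 < \det (N y).
    rewrite det_mulmx det_inv mulrC -(pmulr_rgt0 _ (x := \det (S y) ^+ 2)).
      by rewrite expr2 -mulrA mulVKf// -unitfE -unitmxE SU.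
    by rewrite exprn_even_gt0//= -unitfE -unitmxE SU.
  by rewrite det_inv invr_gt0 detN mulKmx// unitmxE unitfE gt_eqF.
pose g y := t *m Lf y.
have Dg : is_derive x xi g ('D_xi g x).
  by apply: (@Cr_derivable _ _ 0 _ _ U) => //; apply: Cr_mulmxl.
split; first by case: Dg.
apply/eqP => D0; rewrite -/g D0 in Dg.
pose M y := L (beta (y - x0)).
have gtE y : g y + t = tau *m N y *m G y.
  by rewrite -[tau *m N y *m _]mulmxA /g tE -(mulmxA tau) GLf mulmxBr subrK.
have gE y : (g y + t) *m PB = (g y + t) *m PA *m M y.
  by rewrite gtE -(mulmxA _ (G y) PA) -(mulmxA _ (G y) PB) GPA GPB mulmx1.
have gxPA : (g x + t) *m PA = tau.
  by rewrite gtE -[LHS]mulmxA GPA mulmx1 /N /S -/Q mulmxV// mulmx1.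
pose bx y := beta (y - x0).
have DM : is_derive x xi M ('D_('D_xi bx x) L (bx x)).
  have [dL _] := CL 1%N; have [db _] : Cr 1 setT bx by exact: Cr_slice.
  have dLb : differentiable (L \o bx) x.
    by apply: differentiable_comp; [exact: db|exact: dL].
  suff : is_derive x xi (L \o bx) ('D_('D_xi bx x) L (bx x)) by [].
  split; first exact: diff_derivable.
  rewrite deriveE// diff_comp//=; [|exact: db|exact: dL].
  rewrite [RHS]deriveE; last exact: dL.
  by rewrite deriveE//; exact: db.
have cM p r (c : 'M[R]_(p, r)) : is_derive x xi (cst c) 0 by exact: is_derive_cst.
have Dgt : is_derive x xi (fun y => g y + t) 0.
  by apply: (is_derive_eq (is_deriveD Dg (cM _ _ t))); rewrite addr0.
have tau0 : tau *m 'D_('D_xi bx x) L (bx x) = 0.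
  have [_ E1] := is_derive_mulmx Dgt (cM _ _ PB).
  have [_ E2] := is_derive_mulmx (is_derive_mulmx Dgt (cM _ _ PA)) DM.
  move: E1; rewrite /cst (_ : (fun y => _) = (fun y => (g y + t) *m PA *m M y)).
    by rewrite E2 gxPA !mul0mx !mulmx0 !addr0 mul0mx add0r.
  by rewrite funeqE => y; exact: gE.
have [tauz|bz] := dinj tau0.
  by move: t0; rewrite tE tauz mul0mx eqxx.
rewrite bz derive0 in DM.
have Dy : is_derive x xi (fun y => y - x0) xi.
  apply: (is_derive_eq (is_deriveB (is_derive_id x xi) (cM _ _ x0))).
  by rewrite subr0.
have Db : is_derive x xi bx 0.
  rewrite -bz; exact: (Cr_derivable xi (Cr_slice 1%N) (Logic.I : setT x)).
have xiPB : xi *m PB = xi *m PA *m M x.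
  have [_ E1] := is_derive_mulmx Dy (cM _ _ PB).
  have [_ E2] := is_deriveD Db (is_derive_mulmx (is_derive_mulmx Dy (cM _ _ PA)) DM).
  move: E1; rewrite /cst (_ : (fun y => _) = bx + (fun y => (y - x0) *m PA *m M y)).
    by rewrite E2 !mulmx0 !addr0 add0r => <-.
  by rewrite funeqE => y; rewrite -betaE.
have xiE : xi = xi *m PA *m G x.
  by rewrite mulmxDr [in RHS]mulmxA -xiPB -!mulmxA -mulmxDr PAB mulmx1.
have xiPA : xi *m PA = 0.
  by rewrite -(mulmxK Qu (xi *m PA)) mulmxA -xiE pxi mul0mx.
by move: xi0; rewrite xiE xiPA mul0mx eqxx.
Qed.

Lemma model_fibration : smooth_nondeg_fibration setT G.
Proof.
have GE x y : fiber G x y -> G y = G x by rewrite /G => /beta_fiber ->.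
split; last exact: model_nondegenerate.
- split; [exact: oT|by move=> x _; exact: W_free|by []|].
  by move=> x y _ /GE ->; exact: frame_equiv_refl.
- move=> x _; exists setT, G; split=> //; first exact: oT.
    by apply: Cr_smooth; [exact: oT|exact: Cr_model].
  by move=> y _; exact: frame_equiv_refl.
- move=> x _.
  have Cid (V : normedModType R) m : Cr m setT (fun y : V => y).
    by apply: (@Cr_linear _ _ _ m setT idfun); [exact: oT|move=> y; exact: cvg_id].
  have CB m (V : normedModType R) (c : V) : Cr m setT (fun y : V => y - c).
    by apply: CrD; [exact: oT|exact: Cid|exact: Cr_cst].
  exists setT, (fun b => x0 + b *m B), W, setT,
    (fun y => (beta (y - x0), (y - x0) *m PA)).
  split; first by split=> //; exact: oT.
  split.
    split; apply: Cr_smooth => [|m]; try exact: oT.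
    + apply: CrD; [exact: oT|exact: Cr_cst|].
      by apply: Cr_mulmxr; [exact: oT|exact: Cid].
    + apply: CrD; [exact: oT|exact: Cr_cst|].
      by apply: Cr_mulmxr; [exact: oT|exact: CL].
    + apply: Cr_pair; [exact: oT| |].
        exact: Cr_slice.
      by apply: Cr_mulmxr; [exact: oT|exact: CB].
  have bB b c : beta (b *m B + c *m W b) = b.
    apply: slice_eq.
    rewrite (mulmxDl (b *m B) _ PA) (mulmxDl (b *m B) _ PB).
    rewrite -(mulmxA b B) -(mulmxA c (W b)) -(mulmxA b B) -(mulmxA c (W b)).
    by rewrite W_PA W_PB BPB BPA mulmx0 add0r !mulmx1.
  split.
    move=> b _; rewrite /G (addrC x0) addrK.
    by rewrite -[b *m B]addr0 -[0](mul0mx _ (W b)) bB; exact: frame_equiv_refl.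
  split=> // [b c _|y _].
    rewrite (_ : _ - x0 = b *m B + c *m W b); last first.
      by rewrite -[x0 + _ + _]addrA [x0 + _]addrC addrK.
    rewrite bB (mulmxDl (b *m B)) -(mulmxA b B) -(mulmxA c (W b)) W_PA BPA.
    by rewrite mulmx0 add0r mulmx1.
  have zE : y - x0 = (y - x0) *m PA *m A +
      (beta (y - x0) + (y - x0) *m PA *m L (beta (y - x0))) *m B.
    by rewrite betaE -!mulmxA -mulmxDr PAB mulmx1.
  split=> //=; rewrite -[RHS](subrK x0) [in RHS]zE (mulmxDl (beta _)) /W mulmxDr mulmxA.
  move: (_ *m A) (beta _ *m B) (_ *m L _ *m B) => a b c.
  by apply/rowP => j; rewrite !mxE; ring.
Qed.

End Model.

(** * Extraction of the graph germ *)

Lemma derive_line_eq (R : realType) (V W : normedModType R) (f g : V -> W) x v :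
  (\forall h \near (0 : R), f (x + h *: v) = g (x + h *: v)) ->
  'D_v f x = 'D_v g x.
Proof.
move=> fg.
have fgx : f x = g x by have := nbhs_singleton fg; rewrite scale0r addr0.
have E (f' g' : V -> W) : f' x = g' x ->
    (\forall h \near (0 : R), f' (x + h *: v) = g' (x + h *: v)) ->
    \forall h \near (0 : R),
      h^-1 *: (f' (h *: v + x) - f' x) = h^-1 *: (g' (h *: v + x) - g' x).
  by move=> E0; apply: filterS => h; rewrite addrC => ->; rewrite E0.
rewrite /derive; congr (lim _); rewrite eqEsubset; split;
  apply/near_eq_cvg/cvg_within/E => //.
by apply: filterS fg => h ->.
Qed.

Lemma mulmx_norm_le (R : realType) p q r (A : 'M[R]_(p, q)) (B : 'M[R]_(q, r)) :
  `|A *m B| <= q%:R * `|A| * `|B|.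
Proof.
apply: normr_mx_le => [|i j]; first by rewrite !mulr_ge0.
rewrite mxE; apply: le_trans (ler_norm_sum _ _ _) _.
apply: le_trans (_ : \sum_(l < q) `|A| * `|B| <= _).
  by apply: ler_sum => l _; rewrite normrM ler_pM// normr_entry.
by rewrite sumr_const card_ord -mulrA mulr_natl.
Qed.

Section Adapted.
Context {R : realType} {k n : nat}.

Lemma perp_basis (A : 'M[R]_(k, n)) : row_free A ->
  exists B : 'M[R]_(n - k, n),
    [/\ row_free B, B *m A^T = 0 & (kermx A^T <= B)%MS].
Proof.
move=> fA; have := mxrank_ker A^T; rewrite mxrank_tr (eqP fA) => <-.
exists (row_base (kermx A^T)); split; first exact: row_base_free.
  by apply/sub_kermxP; rewrite eq_row_base.
by rewrite eq_row_base.
Qed.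

Lemma adapted_frame (A : 'M[R]_(k, n)) : row_free A ->
  exists (B : 'M[R]_(n - k, n)) (PA : 'M[R]_(n, k)) (PB : 'M[R]_(n, n - k)),
    [/\ A *m PA = 1%:M, B *m PB = 1%:M, A *m PB = 0 & B *m PA = 0] /\
    [/\ PA *m A + PB *m B = 1%:M, B *m A^T = 0 &
        exists C, PA = A^T *m C].
Proof.
move=> fA; have [B [fB BA kerB]] := perp_basis fA.
have AB : A *m B^T = 0 by rewrite -[A]trmxK -trmx_mul BA trmx0.
have uA := gram_unit fA; have uB := gram_unit fB.
pose PA := A^T *m invmx (A *m A^T); pose PB := B^T *m invmx (B *m B^T).
have APA : A *m PA = 1%:M by rewrite mulmxA mulmxV.
have BPB : B *m PB = 1%:M by rewrite mulmxA mulmxV.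
have APB : A *m PB = 0 by rewrite mulmxA AB mul0mx.
have BPA : B *m PA = 0 by rewrite mulmxA BA mul0mx.
have PAE : exists C, PA = A^T *m C by exists (invmx (A *m A^T)).
have PAT : PA *m A *m A^T = A^T by rewrite -!mulmxA mulVmx// mulmx1.
clearbody PA PB.
exists B, PA, PB; split=> //; split=> //.
pose P := 1%:M - (PA *m A + PB *m B).
have /submxP[X PX] : (P <= B)%MS.
  apply: submx_trans kerB; apply/sub_kermxP.
  by rewrite mulmxBl mul1mx mulmxDl PAT -mulmxA BA mulmx0 addr0 subrr.
have P0 : P = 0.
  have : P *m PB = 0.
    by rewrite mulmxBl mul1mx mulmxDl -!mulmxA APB BPB mulmx0 add0r mulmx1 subrr.
  by rewrite PX -mulmxA BPB mulmx1 => ->; rewrite mul0mx.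
by apply/esym/eqP; rewrite -subr_eq0; apply/eqP.
Qed.

End Adapted.

Section LocalGraph.
Context {R : realType} {k n : nat}.
Notation q := (n - k)%N.
Variables (T : set 'rV[R]_n) (F : 'rV[R]_n -> 'M[R]_(k, n)) (x0 : 'rV[R]_n).
Hypothesis fibF : fibration T F.
Hypothesis smoothF : smooth_direction T F.
Hypothesis nondegF : Defs.nondegenerate T F.
Hypothesis Tx0 : T x0.
Variables (B : 'M[R]_(q, n)) (PA : 'M[R]_(n, k)) (PB : 'M[R]_(n, q)).
Let A := F x0.
Hypotheses (APA : A *m PA = 1%:M) (BPB : B *m PB = 1%:M).
Hypotheses (APB : A *m PB = 0) (BPA : B *m PA = 0).
Hypothesis (PAB : PA *m A + PB *m B = 1%:M).
Hypothesis BAT : B *m A^T = 0.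
Variable C : 'M[R]_k.
Hypothesis PAE : PA = A^T *m C.

Lemma graph_unique K K' :
  frame_equiv (A + K *m B) (A + K' *m B) -> K = K'.
Proof.
move=> [M [_ E]].
have M1 : M = 1%:M.
  have := congr1 (mulmx^~ PA) E; rewrite /= -mulmxA !mulmxDl -!mulmxA BPA !mulmx0.
  by rewrite !addr0 APA mulmx1.
have := congr1 (mulmx^~ PB) E; rewrite /= M1 mul1mx !mulmxDl -!mulmxA BPB.
by rewrite APB !add0r !mulmx1.
Qed.

Lemma local_graph x : T x -> 0 < \det (F x *m PA) ->
  exists (U : set 'rV[R]_n) (L : 'rV[R]_n -> 'M[R]_(k, q)),
    [/\ open U, U x, U `<=` T, (forall m, Cr m U L) &
        forall y, U y -> frame_equiv (F y) (A + L y *m B)].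
Proof.
move=> Tx dx; have [U [G [oU Ux UT sG FG]]] := smoothF Tx.
have CG m : Cr m U (fun y => G y *m PA).
  by apply: Cr_mulmxr => //; exact: smooth_Cr.
pose U' := U `&` [set y | 0 < \det (G y *m PA)].
have oU' : open U'.
  rewrite openE => y [Uy dy]; apply: filterI; first exact: open_nbhs_nbhs.
  have cd := Cr_cts (Cr_det oU (CG 0%N)) Uy.
  exact: (cd [set r | 0 < r] (lt_nbhsr dy)).
have U'u y : U' y -> G y *m PA \in unitmx.
  by move=> [_ dy]; rewrite unitmxE unitfE gt_eqF.
exists U', (fun y => invmx (G y *m PA) *m (G y *m PB)); split=> //.
- split=> //=; have [M [M0 ->]] := FG _ Ux.
  by rewrite -mulmxA det_mulmx mulr_gt0.
- by move=> y [Uy _]; exact: UT.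
- move=> m; have U'U : U' `<=` U by move=> y [].
  apply: Cr_mulmx => //.
    by apply: Cr_invmx => //; exact: Cr_sub (CG m).
  by apply: Cr_mulmxr => //; apply: (Cr_sub U'U); exact: smooth_Cr.
- move=> y U'y; have [Uy dy] := U'y.
  apply: frame_equiv_trans (FG _ Uy) _.
  exists (invmx (G y *m PA)); rewrite det_inv invr_gt0; split=> //.
  rewrite -[A in LHS](mulKmx (U'u _ U'y)) -(mulmxA _ (G y *m PB)) -mulmxDr.
  congr (_ *m _).
  by rewrite -!mulmxA -mulmxDr PAB mulmx1.
Qed.

Lemma fiber_graph p K c : T p -> frame_equiv (F p) (A + K *m B) ->
  fiber F p (p + c *m (A + K *m B)).
Proof. by move=> Tp [M [_ ->]]; exists (c *m M); rewrite mulmxA. Qed.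

Lemma graph_germ :
  exists (U : set 'rV[R]_q) (L : 'rV[R]_q -> 'M[R]_(k, q)),
    [/\ open U, U 0, (forall m, Cr m U L) & L 0 = 0] /\
    [/\ forall b, U b -> T (x0 + b *m B) /\
          frame_equiv (F (x0 + b *m B)) (A + L b *m B),
        forall (c : 'rV[R]_k) b, c *m 'd L 0 b = 0 -> c = 0 \/ b = 0 &
        forall (c : 'rV[R]_k) b, b + c *m 'd L 0 b = 0 -> b = 0].
Proof.
have [|U0 [L0 [oU0 U0x U0T CL0 FL0]]] := @local_graph x0 Tx0.
  by rewrite APA det1.
have Cs m : Cr m setT (fun b : 'rV[R]_q => x0 + b *m B).
  apply: CrD; [exact: openT|exact: Cr_cst openT|].
  apply: Cr_mulmxr; first exact: openT.
  by apply: (@Cr_linear _ _ _ m setT idfun openT) => y; exact: cvg_id.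
pose U := (fun b : 'rV[R]_q => x0 + b *m B) @^-1` U0.
have oU : open U by apply: open_comp => // b _; exact: (Cs 0%N).
have U00 : U 0 by rewrite /U /= mul0mx addr0.
pose L b := L0 (x0 + b *m B).
have CL m : Cr m U L.
  by apply: (Cr_comp_mx oU oU0 _ (CL0 m)) => //; exact: Cr_sub (Cs m).
have L00 : L 0 = 0.
  apply: graph_unique; rewrite mul0mx addr0 /L mul0mx addr0.
  exact/frame_equiv_sym/FL0.
have UP b : U b -> T (x0 + b *m B) /\
    frame_equiv (F (x0 + b *m B)) (A + L b *m B).
  by move=> Ub; split; [exact: U0T|exact: FL0].
have dL : differentiable L 0 by have [d _] := CL 1%N; exact: d.
have ns (c : 'rV[R]_k) b : c *m 'd L 0 b = 0 -> c = 0 \/ b = 0.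
  move=> E.
  have [->|c0] := eqVneq c 0; [by left|right].
  apply/eqP/negPn/negP => b0.
  have [U1 [Lf [oU1 U1x U1T gr nd]]] := nondegF Tx0.
  have bB0 : b *m B != 0.
    by apply: contra_neq b0 => Z; rewrite -[b]mulmx1 -BPB mulmxA Z mul0mx.
  have cA0 : c *m A != 0.
    by apply: contra_neq c0 => Z; rewrite -[c]mulmx1 -APA mulmxA Z mul0mx.
  have pB a : in_perp A (a *m B) by rewrite /in_perp -mulmxA BAT mulmx0.
  have [_ /eqP] := nd _ _ (pB b) bB0 (submxMl c A) cA0; apply.
  have cl (V : normedModType R) (v w : V) : (fun h : R => v + h *: w) @ 0 --> v.
    rewrite -[X in _ --> X]addr0 -[X in _ --> _ + X](scale0r w).
    by apply: cvgD; [exact: cvg_cst|apply: cvgZr_tmp; exact: cvg_id].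
  have -> : 'D_(b *m B) (fun y => c *m A *m Lf y) x0 =
            'D_(b *m B) (fun y => c *m L0 y *m B) x0.
    apply: derive_line_eq; near=> h.
    have E1 : x0 + h *: (b *m B) = x0 + (h *: b) *m B by rewrite scalemxAl.
    have U1h : U1 (x0 + h *: (b *m B)).
      by near: h; apply: (cl _ x0 (b *m B)); exact: open_nbhs_nbhs.
    have U0h : U0 (x0 + h *: (b *m B)).
      by near: h; apply: (cl _ x0 (b *m B)); exact: open_nbhs_nbhs.
    have [|G1 G2] := gr _ U1h; first by rewrite E1 addrC addKr; exact: pB.
    have [M [_ E2]] := frame_equiv_trans G2 (FL0 _ U0h).
    have M1 : M = 1%:M.
      have P1 : (A + L0 (x0 + h *: (b *m B)) *m B) *m PA = 1%:M.
        by rewrite mulmxDl -mulmxA BPA mulmx0 addr0.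
      have P2 : (A + A *m Lf (x0 + h *: (b *m B))) *m PA = 1%:M.
        by rewrite mulmxDl APA PAE mulmxA G1 mul0mx addr0.
      by have := congr1 (mulmx^~ PA) E2; rewrite /= P1 -mulmxA P2 mulmx1.
    have : A *m Lf (x0 + h *: (b *m B)) = L0 (x0 + h *: (b *m B)) *m B.
      by move: E2; rewrite M1 mul1mx => /addrI.
    by rewrite -!mulmxA => ->.
  have DL0 := Cr_derivable (b *m B) (CL0 1%N) U0x.
  have cM p r (M : 'M[R]_(p, r)) : is_derive x0 (b *m B) (cst M) 0.
    exact: is_derive_cst.
  have [_ ->] := is_derive_mulmx (is_derive_mulmx (cM _ _ c) DL0) (cM _ _ B).
  rewrite mul0mx add0r mulmx0 addr0.
  suff -> : 'D_(b *m B) L0 x0 = 'd L 0 b by rewrite E mul0mx.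
  have HE : (fun h : R => h^-1 *: ((L0 \o shift x0) (h *: (b *m B)) - L0 x0)) =
            (fun h : R => h^-1 *: ((L \o shift 0) (h *: b) - L 0)).
    by rewrite funeqE => h /=; rewrite /L mul0mx !addr0 -scalemxAl [x0 + _]addrC.
  by rewrite -(deriveE b dL) /derive HE.
exists U, L; split=> //; split=> // c b E.
suff D0 : 'd L 0 b = 0 by rewrite D0 mulmx0 addr0 in E.
pose y (a : 'rV[R]_q) := x0 + a *m B + c *m (A + L a *m B).
have Tx1 : T (x0 + c *m A).
  have [_ _ fT _] := fibF; apply: (fT _ Tx0); by exists c.
have F1 : frame_equiv (F x0) (F (x0 + c *m A)).
  by have [_ _ _ fE] := fibF; apply: (fE _ _ Tx0); exists c.
have [|U1 [L1 [oU1 U1x U1T CL1 FL1]]] := local_graph Tx1.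
  by have [M [M0 ->]] := F1; rewrite -mulmxA APA mulmx1.
have y0 : y 0 = x0 + c *m A by rewrite /y L00 !mul0mx !addr0.
have Cy m : Cr m U y.
  apply: CrD => //; first exact: Cr_sub (Cs m).
  apply: Cr_mulmxl => //; apply: CrD => //; first exact: Cr_cst.
  by apply: Cr_mulmxr.
have dy : differentiable y 0 by have [d _] := Cy 1%N; exact: d.
have dL1 : differentiable L1 (y 0).
  by rewrite y0; have [d _] := CL1 1%N; exact: d.
have LL1 : \forall a \near (0 : 'rV[R]_q), L a = (L1 \o y) a.
  have Uy : \forall a \near (0 : 'rV[R]_q), U1 (y a).
    apply: (Cr_cts (Cy 0%N) U00); rewrite y0; exact: open_nbhs_nbhs.
  near=> a; apply: graph_unique.
  have Ua : U a by near: a; exact: open_nbhs_nbhs.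
  have [Ta Fa] := UP _ Ua.
  have U1a : U1 (y a) by near: a.
  apply: frame_equiv_trans (frame_equiv_sym Fa) _.
  apply: frame_equiv_trans (FL1 _ U1a).
  have [_ _ _ fE] := fibF; exact: (fE _ _ Ta (fiber_graph c Ta Fa)).
rewrite -deriveE// (near_eq_derive _ LL1) deriveE; last exact: differentiable_comp.
rewrite diff_comp//= -[X in 'd L1 _ X]deriveE//.
have cM p r (M : 'M[R]_(p, r)) : is_derive (0 : 'rV[R]_q) b (cst M) 0.
  exact: is_derive_cst.
have DL := Cr_derivable b (CL 1%N) U00.
have Did := is_derive_mulmx (is_derive_id (0 : 'rV[R]_q) b) (cM _ _ B).
have [_ ->] := is_deriveD (is_deriveD (cM _ _ x0) Did)
  (is_derive_mulmx (cM _ _ c) (is_deriveD (cM _ _ A) (is_derive_mulmx DL (cM _ _ B)))).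
rewrite !mulmx0 !mul0mx !addr0 !add0r deriveE// mulmxA -mulmxDl E mul0mx.
exact: linear0.
Unshelve. all: by end_near. Qed.

End LocalGraph.

Lemma nonsingular_pencil_lower (R : realType) k q
    (D : {linear 'rV[R]_q -> 'M[R]_(k, q)}) :
  (forall (c : 'rV[R]_k) b, c *m D b = 0 -> c = 0 \/ b = 0) ->
  (forall (c : 'rV[R]_k) b, b + c *m D b = 0 -> b = 0) ->
  exists2 kappa, 0 < kappa & forall (c : 'rV[R]_k) (b : 'rV[R]_q),
    [/\ kappa * `|b| <= `|b + c *m D b|,
        kappa * `|c| * `|b| <= `|b + c *m D b| &
        kappa * `|c| * `|b| <= `|c *m D b|].
Proof.
move=> ns ev.
pose beta (v : 'rV[R]_(1 + k)) (b : 'rV[R]_q) : 'rV[R]_q :=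
  lsubmx v *m b + rsubmx v *m D b.
have [||| kappa k0 kP] := @bilinear_lower R _ _ _ beta.
- move=> b a u v; rewrite /beta !linearP /= !mulmxDl scalerDr -!scalemxAl.
  by rewrite addrACA.
- move=> v a u w; rewrite /beta (linearP D) !mulmxDr scalerDr -!scalemxAr.
  by rewrite addrACA.
- move=> v b; rewrite /beta => E.
  have lE : lsubmx v *m b = lsubmx v ord0 ord0 *: b.
    by rewrite -mul_scalar_mx; congr (_ *m _); exact: mx11_scalar.
  have [a0|a0] := eqVneq (lsubmx v ord0 ord0) 0.
    move: E; rewrite lE a0 scale0r add0r => /ns[r0|->]; last by right.
    left; rewrite -[v]hsubmxK r0 (mx11_scalar (lsubmx v)) a0 raddf0.
    exact: row_mx0.
  right; apply: (ev ((lsubmx v ord0 ord0)^-1 *: rsubmx v)).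
  have := congr1 ( *:%R (lsubmx v ord0 ord0)^-1) E.
  by rewrite lE scalerDr scalerA mulVf// scale1r scaler0 -scalemxAl.
exists kappa => // c b.
have bE (a : R) : beta (row_mx a%:M c) b = a *: b + c *m D b.
  by rewrite /beta row_mxKl row_mxKr mul_scalar_mx.
have nc (a : R) : `|c| <= `|row_mx a%:M c : 'rV[R]_(1 + k)|.
  apply: normr_mx_le => // i j.
  by have := normr_entry (row_mx a%:M c) i (rshift 1 j); rewrite row_mxEr.
have n1 : 1 <= `|row_mx (1 : R)%:M c : 'rV[R]_(1 + k)|.
  have := normr_entry (row_mx (1 : R)%:M c) ord0 (lshift k ord0).
  by rewrite row_mxEl mxE eqxx normr1.
have := kP (row_mx 1%:M c) b; have := kP (row_mx 0%:M c) b.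
rewrite !bE scale1r scale0r add0r => K0 K1; split.
- by apply: le_trans K1; rewrite ler_wpM2r// ler_peMr// ltW.
- by apply: le_trans K1; rewrite ler_wpM2r// ler_pM2l.
- by apply: le_trans K0; rewrite ler_wpM2r// ler_pM2l.
Qed.

(* Clamping the argument of [L - D], rather than multiplying it by a bump
   function, keeps its Lipschitz constant proportional to the one near [0]. *)
Lemma graph_germ_extend (R : realType) k q (U : set 'rV[R]_q)
    (L : 'rV[R]_q -> 'M[R]_(k, q)) (kappa : R) :
  open U -> U 0 -> (forall m, Cr m U L) -> 0 < kappa ->
  exists (L' : 'rV[R]_q -> 'M[R]_(k, q)) (r : R),
    [/\ 0 < r, forall m, Cr m setT L',
        forall b, `|b| < r -> U b /\ L' b = L b &
        forall (c : 'rV[R]_k) (b b' : 'rV[R]_q),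
          `|c *m (L' b - L' b' - 'd L 0 (b - b'))|
             <= kappa / 2 * `|c| * `|b - b'|].
Proof.
move=> oU U0 CL kappa0.
have dL : differentiable L 0 by have [d _] := CL 1%N; exact: d.
pose E b := L b - 'd L 0 b.
have oT : open [set: 'rV[R]_q] by exact: openT.
have CD m (V : set 'rV[R]_q) : open V -> Cr m V (fun b => 'd L 0 b).
  by move=> oV; apply: Cr_linear => //; exact: diff_continuous.
have CE m : Cr m U E.
  apply: (@Cr_eq _ _ _ _ _ (fun b => L b + (-1) *: 'd L 0 b)) => //.
    by move=> x _; rewrite scaleN1r.
  apply: CrD => //; apply: (Cr_linmx (l := fun M => (-1) *: M)) => //.
    by move=> a u v; exact: linearP.
  exact: CD.
have E0 v : 'D_v E 0 = 0.
  have d : differentiable ('d L 0 : 'rV[R]_q -> 'M[R]_(k, q)) 0.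
    by have [d _] := CD 1%N U oU; exact: d.
  have dl v' : derivable L 0 v' by exact: diff_derivable.
  have dd v' : derivable ('d L 0 : 'rV[R]_q -> 'M[R]_(k, q)) 0 v'.
    exact: diff_derivable.
  have -> : 'D_v E 0 = 'D_v L 0 - 'D_v ('d L 0 : 'rV[R]_q -> 'M[R]_(k, q)) 0.
    exact: deriveB.
  have dlin : 'd ('d L 0 : 'rV[R]_q -> 'M[R]_(k, q)) 0 = 'd L 0 :> ('rV[R]_q -> _).
    exact: (@diff_lin R _ _ ('d L 0) 0 (diff_continuous dL)).
  have e1 : 'D_v L 0 = 'd L 0 v := deriveE v dL.
  have e2 : 'D_v ('d L 0 : 'rV[R]_q -> 'M[R]_(k, q)) 0 = 'd L 0 v.
    by apply: (etrans (deriveE v d)); exact: (congr1 (@^~ v) dlin).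
  apply: (etrans (congr2 (fun a b => a - b) e1 e2)).
  exact: subrr.
have [K K0 KP] := @clampv_lipschitz R.
pose e := kappa / 2 / (k.+1%:R * K).
have e0 : 0 < e by rewrite !divr_gt0// mulr_gt0.
have [r r0 [rU rL]] := lipschitz_small oU U0 (CE 1%N) E0 e0.
pose s := r / 3.
have s0 : 0 < s by rewrite divr_gt0.
have cb (b : 'rV[R]_q) : ball 0 r (clampv s b).
  rewrite -ball_normE /= sub0r normrN; apply: le_lt_trans (clampv_le _ s0) _.
  by rewrite /s; lra.
exists (fun b => 'd L 0 b + E (clampv s b)), s; split=> // [m|b bs|c b b'].
- apply: CrD => //; first exact: CD.
  apply: (Cr_comp_mx oT oU _ (CE m) (Cr_clampv q m s)) => x _; exact/rU/cb.
- split; first by have := rU _ (cb b); rewrite clampv_id// ltW.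
  by rewrite clampv_id ?ltW// /E addrC subrK.
- rewrite (_ : _ - _ = E (clampv s b) - E (clampv s b')); last first.
    rewrite linearB /=; move: (E _) (E _) ('d L 0 b) ('d L 0 b') => M1 M2 M3 M4.
    by apply/matrixP => i j; rewrite !mxE; ring.
  apply: le_trans (mulmx_norm_le _ _) _.
  have H : `|E (clampv s b) - E (clampv s b')| <= e * (K * `|b - b'|).
    apply: le_trans (rL _ _ (cb _) (cb _)) _.
    by rewrite ler_pM2l//; exact: KP.
  have ke : k%:R * e * K <= kappa / 2.
    have k1 : k.+1%:R != 0 :> R by rewrite pnatr_eq0.
    have K1 : K != 0 by rewrite gt_eqF.
    have -> : k%:R * e * K = kappa / 2 * (k%:R / k.+1%:R).
      rewrite /e; move: k.+1%:R k%:R k1 => x y x0.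
      by field; rewrite x0 K1.
    apply: ler_piMr; first by rewrite divr_ge0// ltW.
    by rewrite ler_pdivrMr// mul1r ler_nat.
  have nb : 0 <= `|c| * `|b - b'| by rewrite mulr_ge0.
  apply: le_trans (_ : k%:R * `|c| * (e * (K * `|b - b'|)) <= _).
    by rewrite ler_wpM2l// mulr_ge0.
  have := ler_wpM2r nb ke; lra.
Qed.

Theorem theorem1p5 (R : realType) (k n : nat) (T : set 'rV[R]_n)
    (F : 'rV[R]_n -> 'M[R]_(k, n)) (x0 : 'rV[R]_n) :
  smooth_nondeg_fibration T F -> T x0 ->
  exists F' : 'rV[R]_n -> 'M[R]_(k, n),
    smooth_nondeg_fibration setT F' /\
    exists W : set 'rV[R]_n,
      [/\ open W, fiber F x0 `<=` W, W `<=` T &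
          (forall y, W y -> frame_equiv (F y) (F' y))].
Proof.
move=> [fibF smF _ ndF] Tx0; have [_ freeF fT fE] := fibF.
have [B [PA [PB [[APA BPB APB BPA] [PAB BAT [C PAE]]]]]] :=
  adapted_frame (freeF _ Tx0).
have [U [L [[oU U0 CL L0] [UF ns ev]]]] :=
  graph_germ fibF smF ndF Tx0 APA BPB APB BPA PAB BAT PAE.
have [kappa kappa0 kP] := nonsingular_pencil_lower ns ev.
have [L' [r [r0 CL' L'E L'D]]] := graph_germ_extend oU U0 CL kappa0.
have D1 (c : 'rV[R]_k) (b : 'rV[R]_(n - k)) : kappa * `|b| <= `|b + c *m 'd L 0 b|
  by have [] := kP c b.
have Dc (c : 'rV[R]_k) (b : 'rV[R]_(n - k)) : kappa * `|c| * `|b| <= `|b + c *m 'd L 0 b|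
  by have [] := kP c b.
have D0 (c : 'rV[R]_k) (b : 'rV[R]_(n - k)) : kappa * `|c| * `|b| <= `|c *m 'd L 0 b|
  by have [] := kP c b.
have [beta [Cbeta betaE]] :=
  slice_coordinate APA BPB APB BPA PAB CL' kappa0 D1 Dc L'D.
have inj := graph_map_inj kappa0 D1 Dc L'D.
have dinj := deriv_graph_inj CL' kappa0 D0 L'D.
exists (fun x => F x0 + L' (beta (x - x0)) *m B); split.
  exact: (model_fibration APA BPB APB BPA PAB x0 CL' Cbeta betaE inj dinj).
have Cr_slice := Cr_slice x0 Cbeta.
pose W := [set x | `|beta (x - x0)| < r].
have WF x : W x -> T x /\ frame_equiv (F x) (F x0 + L' (beta (x - x0)) *m B).
  set z := x - x0; set b := beta z => Wx.
  have [Ub Lb] := L'E _ Wx; have [Tb Fb] := UF _ Ub.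
  have fx : fiber F (x0 + b *m B) x.
    rewrite (_ : x = x0 + b *m B + (z *m PA) *m (F x0 + L b *m B)).
      exact: (fiber_graph _ Tb Fb).
    rewrite -Lb mulmxDr mulmxA -addrA [_ *m B + _]addrCA -(mulmxDl b) betaE.
    by rewrite -!mulmxA -mulmxDr PAB mulmx1 addrC subrK.
  split; first exact: fT fx.
  by rewrite Lb; exact: frame_equiv_trans (frame_equiv_sym (fE _ _ Tb fx)) Fb.
exists W; split=> [|x [c ->]|x /WF[]//|x /WF[]//].
  rewrite (_ : W = (fun x => `|beta (x - x0)|) @^-1` [set s | s < r])//.
  apply: open_comp; last exact: open_lt.
  move=> x _; apply: (continuous_comp (Cr_cts (Cr_slice 0%N) Logic.I)).
  exact: norm_continuous.
rewrite /W /= (addrC x0) addrK (slice_eq betaE inj (b := 0)) ?normr0//.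
have [_ ->] : U 0 /\ L' 0 = L 0 by apply: L'E; rewrite normr0.
by rewrite L0 mulmx0 addr0 -mulmxA APB mulmx0.
Qed.
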